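(* Let $(\gamma,b,\sigma,d,\kappa,\mathrm{k},\pi,\varrho)$ be admissible parameters and let $(P_t)_{t\ge0}$ be the semigroup of the associated $E^\Delta$-valued Markov process $\mathbf{X}=(X,L)$, so that $P_tf_{q,r}(x,n)=e^{-xu_t(q,r)}f_t(q,r)^n$ for all $(x,n)\in E$, $t\ge0$, $(q,r)\in(0,\infty)\times(0,1)$. Then $(P_t)$ is Feller with absorbing state $\Delta$. The space $$D:=\mathrm{Span}\{f_{q,r}:\ q\in(0,\infty),\ r\in(0,1)\}$$ satisfies $P_tD\subset D$ for all $t\ge 0$ and is a core for the generator $\mathscr{L}$ of $\mathbf{X}$. Moreover, $\mathbf{X}$ has the branching property: for all $t\ge0$, $x,y\in[0,\infty)$ and $n,m\in\mathbb{Z}_+$, $$P_t\big((x+y,n+m),\cdot\big)=P_t\big((x,n),\cdot\big)\star P_t\big((y,m),\cdot\big),$$ where $\star$ is the convolution of measures.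
   Context: $\mathbb{R}_+=[0,\infty)$, $\mathbb{Z}_+=\{0,1,\dots\}$, $E=\mathbb{R}_+\times\mathbb{Z}_+$, $E^\Delta=E\cup\{\Delta\}$ its one-point compactification ($\Delta$ stands for all $(x,\ell)$ with $x+\ell=\infty$, and $\Delta+z=\Delta$ for all $z\in E^\Delta$). $C_0(E)$ is the space of continuous functions on $E$ vanishing at infinity; such functions are set to $0$ at $\Delta$. ''Feller'' means that $(P_t)$ is a strongly continuous positive contraction semigroup on $C_0(E)$. For $(q,r)\in(0,\infty)\times(0,1)$, $f_{q,r}(x,\ell)=e^{-qx}r^\ell$. Admissible parameters: $\gamma\in\mathbb{R}$, $b,\sigma,d,\kappa,\mathrm{k}\in\mathbb{R}_+$ and measures $\pi,\varrho$ on $\mathbb{R}_+\times\mathbb{Z}_+$ with $\int(1\wedge y^2)\pi(dy,\{0\})+\sum_{k\ge1}\pi(\mathbb{R}_+,\{k\})<\infty$ and $\int(1\wedge y)\varrho(dy,\{0\})+\sum_{k\ge1}\varrho(\mathbb{R}_+,\{k\})<\infty$. The associated process $\mathbf{X}=(X,L)$ is the unique càdlàg strong Markov process on $E^\Delta$, with cemetery $\Delta$, such that $f(\mathbf{X}_t)-\int_0^t\mathscr{L}f(\mathbf{X}_s)ds$ is a martingale for all $f\in\mathcal{D}$, where ($'$ denoting $\partial_x$) $$\begin{aligned}\mathscr{L}f(x,\ell)=&\ \gamma xf'+b\ell f'+\tfrac{\sigma^2}{2}xf''-\kappa xf-\mathrm{k}\ell f+x\sum_{k\ge0}\int_{\mathbb{R}_+}\big(f(x+y,\ell+k)-f(x,\ell)-y\mathbf{1}_{(0,1)}(y)f'(x,\ell)\big)\pi(dy,\{k\})\\&+\ell\sum_{k\ge0}\int_{\mathbb{R}_+}\big(f(x+y,\ell+k)-f(x,\ell)\big)\varrho(dy,\{k\})+d\ell\big(f(x,\ell-1)-f(x,\ell)\big),\qquad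 \mathscr{L}f(\Delta)=0,\end{aligned}$$ and $\mathcal{D}$ is the set of $f:E\to\mathbb{R}$, $C^2$ in $x$ with $f,f',f''$ vanishing at infinity in $x$ for each $\ell$, and $(x+\ell)(|f|+|f'|+|f''|)(x,\ell)\to0$ as $x+\ell\to\infty$. Its semigroup is characterized by $P_tf_{q,r}(x,n)=\mathbb{E}_{(x,n)}[e^{-qX_t}r^{L_t}]=e^{-xu_t(q,r)}f_t(q,r)^n$, where $(u_t,f_t)\in(0,\infty)\times(0,1)$ is the unique global solution of $\frac{d}{dt}u_t=-\Psi_c(u_t,f_t)$, $\frac{d}{dt}f_t=\Psi_d(u_t,f_t)$, $(u_0,f_0)=(q,r)$, with $$\Psi_c(q,r)=\sum_{k\ge0}\int_{\mathbb{R}_+}\big(e^{-qy}r^k-1+qy\mathbf{1}_{(0,1)}(y)\big)\pi(dy,\{k\})-\gamma q+\tfrac{\sigma^2}{2}q^2-\kappa,$$ $$\Psi_d(q,r)=\sum_{k\ge0}\int_{\mathbb{R}_+}\big(e^{-qy}r^{k+1}-r\big)\varrho(dy,\{k\})-bqr+d(1-r)-\mathrm{k}r.$$ These facts (existence, uniqueness and the formula) may be taken as given. *)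

(* Defs.v *)
From HB Require Import structures.
From mathcomp Require Import all_boot all_order all_algebra.
From mathcomp Require Import all_classical all_reals all_analysis.
From mathcomp Require Import measurable_realfun random_variable.

Set Implicit Arguments.
Unset Strict Implicit.
Unset Printing Implicit Defensive.
Import Order.TTheory GRing.Theory Num.Theory numFieldNormedType.Exports.
Local Open Scope classical_set_scope.
Local Open Scope ring_scope.

(* The half-line is a subtype of R: its neighbourhoods, hence all the limits
   taken in it below (derivatives in particular), are one-sided at 0. *)
Definition Rplus (R : realType) : Type := set_type [set x : R | 0 <= x].
HB.instance Definition _ (R : realType) := Topological.on (Rplus R).
HB.instance Definition _ (R : realType) := SubType.on (Rplus R).

Definition rval (R : realType) (x : Rplus R) : R := \val x.

Definition Rplus0 (R : realType) : Rplus R :=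
  exist _ 0 (mem_set (lexx 0 : [set x : R | 0 <= x] 0)).

HB.instance Definition _ (R : realType) :=
  isPointed.Build (Rplus R) (Rplus0 R).

(* x itself if 0 <= x, and 0 otherwise *)
Definition to_Rplus (R : realType) (x : R) : Rplus R := insubd (Rplus0 R) x.

Definition addRplus (R : realType) (x y : Rplus R) : Rplus R :=
  to_Rplus (rval x + rval y).

Definition E (R : realType) : Type := (Rplus R * nat)%type.
HB.instance Definition _ (R : realType) := Topological.on (E R).
HB.instance Definition _ (R : realType) := Pointed.on (E R).

(* The point None is the state Delta. *)
Definition ED (R : realType) : Type := one_point_compactification (E R).
HB.instance Definition _ (R : realType) := Topological.on (ED R).
HB.instance Definition _ (R : realType) := Pointed.on (ED R).

Definition addED (R : realType) (z w : ED R) : ED R :=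
  if z is Some (x, n) then
    if w is Some (y, m) then Some (addRplus x y, (n + m)%N) else None
  else None.

(* T with its Borel sigma-algebra *)
Definition borel (T : ptopologicalType) : Type := g_sigma_algebraType (@open T).
HB.instance Definition _ (T : ptopologicalType) :=
  Measurable.copy (borel T) (g_sigma_algebraType (@open T)).

Section half_line_calculus.
Context {R : realType}.

Definition diff_quotient (g : Rplus R -> R) (x y : Rplus R) : R :=
  (g y - g x) / (rval y - rval x).

Definition has_derivative (g : Rplus R -> R) (x : Rplus R) (l : R) : Prop :=
  diff_quotient g x y @[y --> x^'] --> l.

Definition derivative (g : Rplus R -> R) (x : Rplus R) : R :=
  lim (diff_quotient g x y @[y --> x^']).

Definition derivable_on (g : Rplus R -> R) : Prop :=
  forall x, has_derivative g x (derivative g x).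

Definition dx (f : E R -> R) (z : E R) : R :=
  derivative (fun x => f (x, z.2)) z.1.

End half_line_calculus.

Section params.
Context {R : realType}.

Record params := Params {
  p_gamma : R; p_b : R; p_sigma : R; p_d : R; p_kappa : R; p_k : R;
  p_pi : {measure set (borel (E R)) -> \bar R};
  p_rho : {measure set (borel (E R)) -> \bar R} }.

Definition slice (k : nat) : set (borel (E R)) := [set z : E R | z.2 = k].

Definition admissible (p : params) : Prop :=
  [/\ 0 <= p_b p, 0 <= p_sigma p, 0 <= p_d p, 0 <= p_kappa p & 0 <= p_k p] /\
  (\int[p_pi p]_(z in slice 0) (Num.min 1 (rval (z : E R).1 ^+ 2))%:E
     + \sum_(1 <= k <oo) p_pi p (slice k) < +oo)%E /\
  (\int[p_rho p]_(z in slice 0) (Num.min 1 (rval (z : E R).1))%:E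
     + \sum_(1 <= k <oo) p_rho p (slice k) < +oo)%E.

(* sum_k \int g(y, k) m(dy, {k}) *)
Definition jump_integral (m : {measure set (borel (E R)) -> \bar R})
    (g : R -> nat -> R) : R :=
  limn (series (fun k => \int[m]_(z in slice k) g (rval (z : E R).1) k)).

Definition small_jump (y : R) : R := y * \1_(`]0, 1[%classic) y.

Definition Psi_c (p : params) (q r : R) : R :=
  jump_integral (p_pi p)
    (fun y k => expR (- (q * y)) * r ^+ k - 1 + q * small_jump y)
  - p_gamma p * q + p_sigma p ^+ 2 / 2 * q ^+ 2 - p_kappa p.

Definition Psi_d (p : params) (q r : R) : R :=
  jump_integral (p_rho p) (fun y k => expR (- (q * y)) * r ^+ k.+1 - r)
  - p_b p * q * r + p_d p * (1 - r) - p_k p * r.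

Definition Lop (p : params) (f : E R -> R) (z : E R) : R :=
  let: (x0, l) := z in
  let: x := rval x0 in
  p_gamma p * x * dx f z + p_b p * l%:R * dx f z
  + p_sigma p ^+ 2 / 2 * x * dx (dx f) z
  - p_kappa p * x * f z - p_k p * l%:R * f z
  + x * jump_integral (p_pi p) (fun y k =>
      f (to_Rplus (x + y), (l + k)%N) - f z - small_jump y * dx f z)
  + l%:R * jump_integral (p_rho p) (fun y k =>
      f (to_Rplus (x + y), (l + k)%N) - f z)
  + p_d p * l%:R * (f (x0, l.-1) - f z).

Definition vanishes_in_x (f : E R -> R) : Prop :=
  forall l e, 0 < e ->
    exists M : R, forall x, M < rval x -> `|f (x, l)| < e.

Definition test_domain (f : E R -> R) : Prop :=
  [/\ (forall l, derivable_on (fun x => f (x, l))),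
      (forall l, derivable_on (fun x => dx f (x, l))),
      (forall l, continuous (fun x : Rplus R => dx (dx f) (x, l))),
      [/\ vanishes_in_x f, vanishes_in_x (dx f) & vanishes_in_x (dx (dx f))] &
      forall e, 0 < e -> exists M : R, forall z, M < rval z.1 + z.2%:R ->
        (rval z.1 + z.2%:R) * (`|f z| + `|dx f z| + `|dx (dx f) z|) < e].

Definition flow_solution (p : params) (q r : R) (u f : Rplus R -> R)
    : Prop :=
  [/\ u (Rplus0 R) = q /\ f (Rplus0 R) = r,
      (forall t, 0 < u t /\ 0 < f t < 1),
      (forall t, has_derivative u t (- Psi_c p (u t) (f t))) &
      (forall t, has_derivative f t (Psi_d p (u t) (f t)))].

End params.
Arguments params : clear implicits.

Definition ext0 (R : realType) (f : E R -> R) (z : ED R) : R :=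
  if z is Some w then f w else 0.

Section processes.
Context {R : realType} {d : measure_display} {Omega : measurableType d}.
Implicit Types (P : ED R -> probability Omega R)
  (X : Rplus R -> {mfun Omega >-> borel (ED R)}).

(* sigma(X_s : s <= t) *)
Definition history X (t : Rplus R) : set (set Omega) :=
  <<s [set B | exists s A, [/\ rval s <= rval t, measurable A &
                               B = X s @^-1` A]] >>.

Definition stopping_time X (tau : Omega -> \bar R) : Prop :=
  (forall w, (0 <= tau w)%E) /\
  forall t, history X t [set w | (tau w <= (rval t)%:E)%E].

Definition stopped_history X (tau : Omega -> \bar R) : set (set Omega) :=
  [set B | measurable B /\
     forall t, history X t (B `&` [set w | (tau w <= (rval t)%:E)%E])].

Definition cadlag X : Prop := forall w,
  (forall t : Rplus R,
     (X s w : ED R) @[s --> within [set s | rval t < rval s] (nbhs t)]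
       --> (X t w : ED R)) /\
  (forall t : Rplus R, 0 < rval t -> exists l : ED R,
     (X s w : ED R) @[s --> within [set s | rval s < rval t] (nbhs t)] --> l).

Definition strong_markov P X : Prop :=
  (forall t A, measurable A ->
     measurable_fun setT (fun z : borel (ED R) => P z (X t @^-1` A))) /\
  forall z tau s A B, stopping_time X tau -> measurable A ->
    stopped_history X tau B ->
    let X_tau w := X (to_Rplus (fine (tau w))) w in
    let X_tau_s w := X (addRplus (to_Rplus (fine (tau w))) s) w in
    let B' := B `&` [set w | (tau w < +oo)%E] in
    P z (B' `&` [set w | A (X_tau_s w)]) =
    (\int[P z]_(w in B') P (X_tau w) (X s @^-1` A))%E.

Definition martingale (Q : probability Omega R)
    (F : Rplus R -> set (set Omega)) (M : Rplus R -> Omega -> R) : Prop :=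
  [/\ (forall t, Q.-integrable setT (EFin \o M t)),
      (forall t (A : set R), measurable A -> F t (M t @^-1` A)) &
      (forall s t B, rval s <= rval t -> F s B ->
         \int[Q]_(w in B) M t w = \int[Q]_(w in B) M s w)].

Definition cemetery X : Prop := forall w s t, rval s <= rval t ->
  X s w = None :> ED R -> X t w = None :> ED R.

Definition associated_process (p : params R) P X : Prop :=
  [/\ (forall z, P z (X (Rplus0 R) @^-1` [set z]) = 1%E),
      cadlag X,
      cemetery X,
      strong_markov P X &
      forall f z, test_domain f -> martingale (P z) (history X)
        (fun t w => ext0 f (X t w)
          - \int[lebesgue_measure]_(s in `[0, rval t])
              ext0 (Lop p f) (X (to_Rplus s) w))].

(* P_t(z, .) *)
Definition transition P X (t : Rplus R) (z : ED R)
    : set (borel (ED R)) -> \bar R :=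
  distribution (P z) (X t).

Definition semigroup P X (t : Rplus R) (f : E R -> R) (z : E R) : R :=
  \int[transition P X t (Some z)]_w ext0 f w.

End processes.

Definition convolution (R : realType) (mu nu : set (borel (ED R)) -> \bar R)
    : set (borel (ED R)) -> \bar R :=
  pushforward (mu \x nu)%E
    (fun zw : borel (ED R) * borel (ED R) =>
       addED zw.1 zw.2 : borel (ED R)).

Section feller.
Context {R : realType}.
Implicit Types (f g : E R -> R) (T : Rplus R -> (E R -> R) -> (E R -> R)).

Definition C0 f : Prop :=
  continuous f /\
  forall e, 0 < e -> exists K : set (E R), compact K /\
    forall z, ~ K z -> `|f z| < e.

Definition sup_dist_le f g (e : R) : Prop := forall z, `|f z - g z| <= e.

Definition is_feller T : Prop :=
  [/\ (forall t f, C0 f -> C0 (T t f)),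
      (forall t a f g, C0 f -> C0 g ->
         T t (fun z => a * f z + g z) = (fun z => a * T t f z + T t g z)),
      (forall f, C0 f -> T (Rplus0 R) f = f) /\
      (forall s t f, C0 f -> T (addRplus s t) f = T s (T t f)),
      (forall t f, C0 f -> (forall z, 0 <= f z) -> forall z, 0 <= T t f z) /\
      (forall t f M, C0 f -> (forall z, `|f z| <= M) ->
         forall z, `|T t f z| <= M) &
      forall f e, C0 f -> 0 < e ->
        \forall t \near Rplus0 R, sup_dist_le (T t f) f e].

(* graph of the infinitesimal generator of the semigroup T on C_0(E) *)
Definition generator T f g : Prop :=
  [/\ C0 f, C0 g &
      forall e, 0 < e -> \forall t \near (Rplus0 R)^',
        sup_dist_le (fun z => (T t f z - f z) / rval t) g e].

(* closure in C_0(E) x C_0(E) of the restriction of A to D *)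
Definition closure_on (A : (E R -> R) -> (E R -> R) -> Prop)
    (D : set (E R -> R)) f g : Prop :=
  forall e, 0 < e -> exists f' g',
    [/\ D f', A f' g', sup_dist_le f f' e & sup_dist_le g g' e].

Definition is_core (A : (E R -> R) -> (E R -> R) -> Prop)
    (D : set (E R -> R)) : Prop :=
  (forall f, D f -> exists g, A f g) /\
  (forall f g, A f g <-> closure_on A D f g).

Definition fqr (q r : R) (z : E R) : R :=
  expR (- (q * rval z.1)) * r ^+ z.2.

(* the linear span of the functions f_{q,r}, q in (0, oo), r in (0, 1) *)
Definition span_fqr : set (E R -> R) :=
  [set f | exists n (c q r : 'I_n -> R),
     (forall i, 0 < q i /\ 0 < r i < 1) /\
     f = (fun z => \sum_(i < n) c i * fqr (q i) (r i) z)].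

End feller.

(* Main.v *)
(* The flow formula makes Span{f_{q,r}} invariant under P_t, and this span is
   uniformly dense in C_0(E): the level indicators 1_{n = k} are limits of
   combinations of r^n as r -> 0, and Bernstein polynomials in s = e^{-x} treat
   the continuous coordinate.  Density and contractivity carry the Feller
   properties from the span to C_0(E), and turn the identity of Laplace
   transforms P_t f_{q,r}(x+y, n+m) = P_t f_{q,r}(x,n) P_t f_{q,r}(y,m) into the
   identity of laws that is the branching property.

   Differentiating exp(-x u_t) f_t^n at t = 0, uniformly in (x,n), shows that
   f_{q,r} lies in the domain of the generator, and a direct computation
   identifies the derivative with the integro-differential operator.  An
   invariant dense subspace D of the domain is a core: the truncated resolvent
   of the difference quotient (T_s - 1) / s shows that 1 - A maps D onto a dense
   set, A is dissipative, and A is closed. *)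
Require Import Defs.
From HB Require Import structures.
From mathcomp Require Import all_boot all_order all_algebra.
From mathcomp Require Import all_classical all_reals all_analysis.
From mathcomp Require Import measurable_realfun random_variable giry.
From mathcomp Require Import ring lra.
Import Order.TTheory GRing.Theory Num.Theory numFieldNormedType.Exports.
Set Implicit Arguments.
Unset Strict Implicit.
Unset Printing Implicit Defensive.
Local Open Scope classical_set_scope.
Local Open Scope ring_scope.

(** * The half-line and the space E *)

(** Analysis in C_0(E) is carried by explicit sup-norm inequalities ([sup_dist_le]) rather than
    Banach-valued integrals, so the resolvent and the integrals of T_s g become finite sums. The
    obstacle to uniformity is that E is not compact and the generator has coefficients growing
    linearly in x + n. It is met by the decay of f_{q,r} at rate c = min(q, -ln r) in x + n: the
    change of the exponent is kept below (c/2)(x + n), and the other half of the decay pays for the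
    polynomial factors. In the density argument only q > 0 is available, so polynomials in s =
    e^{-x} may have no constant term; this is where vanishing at infinity enters, since it means
    vanishing at s = 0. Setting functions to 0 at Delta, together with absorption there, makes both
    the Chapman-Kolmogorov relation and the multiplicativity f_{q,r}(z + w) = f_{q,r}(z) f_{q,r}(w)
    valid on all of E^Delta, while total mass 1 fixes the mass at Delta. *)

Section half_line.
Context {R : realType}.
Implicit Types x y t : Rplus R.

Lemma rval_ge0 x : 0 <= rval x.
Proof. exact: (set_mem (valP x)). Qed.

Lemma rval_inj : injective (@rval R).
Proof. exact: val_inj. Qed.

Lemma to_RplusK (r : R) : 0 <= r -> rval (to_Rplus r) = r.
Proof. by move=> r0; rewrite /rval /to_Rplus insubdK //; exact: mem_set. Qed.

Lemma rvalK : cancel (@rval R) (@to_Rplus R).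
Proof. by move=> x; apply: rval_inj; rewrite to_RplusK// rval_ge0. Qed.

Lemma rval0 : rval (Rplus0 R) = 0.
Proof. by []. Qed.

Lemma rval_to_Rplus (r : R) : rval (to_Rplus r) = Num.max 0 r.
Proof.
case: leP => [/to_RplusK//|r0]; rewrite /to_Rplus /insubd insubF//.
by apply/negP => /set_mem /=; rewrite leNgt r0.
Qed.

Lemma rval_add x y : rval (addRplus x y) = rval x + rval y.
Proof. by rewrite to_RplusK// addr_ge0// rval_ge0. Qed.

Lemma rval_continuous : continuous (@rval R).
Proof. exact: initial_continuous. Qed.

Lemma to_Rplus_continuous : continuous (@to_Rplus R).
Proof.
apply: continuous_comp_initial => r.
rewrite (_ : _ \o _ = fun r => Num.max 0 r); last first.
  by apply/funext => s /=; rewrite -[LHS]/(rval _) rval_to_Rplus.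
apply: (@continuous_max _ _ (cst 0) id); [exact: cvg_cst|exact: cvg_id].
Qed.

(** The continuous retraction [to_Rplus] pulls a neighbourhood in the half-line back to one in R,
    which contains a ball. *)
Lemma near_RplusP x (P : Rplus R -> Prop) :
  (\forall y \near x, P y) <->
  exists2 e : R, 0 < e & forall y, `|rval y - rval x| < e -> P y.
Proof.
split=> [Px|[e e0 Pe]].
  have : \forall r \near rval x, P (to_Rplus r).
    by apply: to_Rplus_continuous; rewrite rvalK.
  case/nbhs_ballP => e /= e0 eP; exists e => // y yx.
  by rewrite -(rvalK y); apply: eP; rewrite /ball /= distrC.
apply: filterS Pe _; have := @rval_continuous x.
by move/cvgr_distC_lt; apply.
Qed.

Lemma near_Rplus0P (P : Rplus R -> Prop) :
  (\forall t \near Rplus0 R, P t) <->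
  exists2 e : R, 0 < e & forall t, rval t < e -> P t.
Proof.
rewrite near_RplusP; split=> -[e e0 Pe]; exists e => // t te; apply: Pe.
  by rewrite rval0 subr0 ger0_norm// rval_ge0.
by move: te; rewrite rval0 subr0 ger0_norm// rval_ge0.
Qed.

Lemma near_dRplus0P (P : Rplus R -> Prop) :
  (\forall t \near (Rplus0 R)^', P t) <->
  exists2 e : R, 0 < e & forall t, 0 < rval t < e -> P t.
Proof.
rewrite -[X in X <-> _]/(\forall t \near Rplus0 R, t != Rplus0 R -> P t).
rewrite near_Rplus0P; split=> -[e e0 Pe]; exists e => // t.
  by move=> /andP[t0 te]; apply: Pe => //; apply: contraTneq t0 => ->; rewrite rval0 ltxx.
move=> te t0; apply: Pe; rewrite te andbT lt_neqAle rval_ge0 andbT eq_sym.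
by apply: contra t0 => /eqP t0; apply/eqP/rval_inj.
Qed.

Lemma continuous_RplusP (g : Rplus R -> R) x : continuous_at x g <->
  forall e : R, 0 < e -> exists2 d : R, 0 < d &
    forall y, `|rval y - rval x| < d -> `|g y - g x| < e.
Proof.
split=> [gx e e0|gx A /nbhs_ballP[e /= e0 eA]].
  have /near_RplusP[d d0 dg] := gx _ (nbhsx_ballx (g x) e e0).
  by exists d => // y /dg; rewrite /ball /= distrC.
have [d d0 dg] := gx e e0; apply/near_RplusP; exists d => // y /dg gyx.
by apply: eA; rewrite /ball /= distrC.
Qed.

(** The second factor is discrete, so every slice is open. *)
Lemma continuous_E (T : topologicalType) (f : E R -> T) :
  (forall n, continuous (fun x => f (x, n))) -> continuous f.
Proof.
move=> cf [x n] A /cf fA.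
exists ([set y | A (f (y, n))], [set n]) => /=.
  by split => //; exact: discrete_set1.
by move=> [y m] /= [Ay ->].
Qed.

Lemma section_continuous (T : topologicalType) (f : E R -> T) n :
  continuous f -> continuous (fun x => f (x, n)).
Proof.
move=> cf x A /cf[[/= U V] [Ux Vn] UV]; apply: filterS Ux => y Uy.
by apply: (UV (y, n)); split => //; exact: nbhs_singleton Vn.
Qed.

(** Its sublevel sets are compact and exhaust E, so it measures the approach to Delta. *)
Definition Enorm (z : E R) : R := rval z.1 + z.2%:R.

Lemma Enorm_ge0 z : 0 <= Enorm z.
Proof. by rewrite addr_ge0// rval_ge0. Qed.

Lemma Enorm_continuous : continuous Enorm.
Proof.
apply: continuous_E => n x.
have cx : continuous_at x (@rval R) by exact: rval_continuous.
have cn : continuous_at x (fun=> n%:R : R) by exact: cst_continuous.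
exact: (cvgD cx cn).
Qed.

Lemma compact_Enorm_le (M : R) : compact [set z | Enorm z <= M].
Proof.
apply: (@subclosed_compact _ _
  ((@to_Rplus R @` `[0, M]) `*` `I_(Num.truncn M).+1)).
- rewrite (_ : mkset _ = Enorm @^-1` [set r | r <= M])//.
  by apply: closed_comp => [? _|]; [exact: Enorm_continuous|exact: closed_le].
- apply: compact_setX.
    apply: continuous_compact; last exact: segment_compact.
    by apply: continuous_subspaceT; exact: to_Rplus_continuous.
  by apply: finite_compact; exact: finite_II.
- move=> [x n]; rewrite /Enorm /= => xnM; split => /=.
    exists (rval x); rewrite ?rvalK//= in_itv/= rval_ge0/=.
    by rewrite (le_trans _ xnM)// lerDl.
  by rewrite /= ltnS truncn_ge_nat ?(le_trans _ xnM) ?addr_ge0 ?lerDr ?rval_ge0.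
Qed.

(** [Enorm] is bounded on compact sets, and its sublevel sets are themselves compact. *)
Lemma C0P (f : E R -> R) : C0 f <->
  (forall n, continuous (fun x => f (x, n))) /\
  forall e : R, 0 < e -> exists M : R, forall z, M < Enorm z -> `|f z| < e.
Proof.
split=> -[cf f0]; split.
- by move=> n; exact: section_continuous.
- move=> e /f0[K [cK Kf]].
  have /compact_bounded [M [_ MK]] : compact (Enorm @` K).
    apply: continuous_compact => //.
    by apply: continuous_subspaceT; exact: Enorm_continuous.
  exists (M + 1) => z Mz; apply: Kf => Kz.
  have /(_ (Enorm z)) /= := MK (M + 1) (ltr_pwDr ltr01 (lexx M)).
  have H : exists2 x, K x & Enorm x = Enorm z by exists z.
  by move=> /(_ H); rewrite ger0_norm ?Enorm_ge0// leNgt Mz.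
- exact: continuous_E.
- move=> e /f0[M Mf]; exists [set z | Enorm z <= M].
  split; first exact: compact_Enorm_le.
  by move=> z /= /negP; rewrite -ltNge; exact: Mf.
Qed.

End half_line.

(** * Borel sets of the compactification *)

Section borel_sets.
Context {R : realType}.

Lemma open_borel (T : ptopologicalType) (A : set T) :
  open A -> measurable (A : set (borel T)).
Proof. by move=> oA; exact: sub_sigma_algebra. Qed.

Lemma continuous_borel_measurable (T : ptopologicalType) (f : T -> R) :
  continuous f -> measurable_fun setT (f : borel T -> R).
Proof.
move=> cf; apply: (measurability _ (RGenOpens.measurableE R)).
by move=> _ [_ [a [b ->]] <-]; rewrite setTI; apply: open_borel; apply: open_comp => // x _; exact: cf.
Qed.

Lemma open_Some (U : set (E R)) : open U ->
  measurable (Some @` U : set (borel (ED R))).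
Proof. by move=> oU; apply: open_borel; exact: one_point_compactification_open_some. Qed.

Lemma measurable_None : measurable ([set None] : set (borel (ED R))).
Proof.
rewrite (_ : [set None] = ~` (Some @` [set: E R])).
  by apply: measurableC; apply: open_Some; exact: openT.
apply/seteqP; split => [[z|]//= _ [w _]//|[z|]//=].
by case; exists z.
Qed.

(** [ext0 f] may jump at [None], so the preimage of an open interval is split into an open part of E
    and possibly the point [None]. *)
Lemma ext0_measurable (f : E R -> R) : continuous f ->
  measurable_fun setT (ext0 f : borel (ED R) -> R).
Proof.
move=> cf; apply: (measurability _ (RGenOpens.measurableE R)).
move=> _ [_ [a [b ->]] <-]; rewrite setTI; set I := `]a, b[%classic.
rewrite (_ : _ @^-1` _ =
    Some @` (f @^-1` I) `|` (if 0 \in I then [set None] else set0)).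
  apply: measurableU.
    by apply: open_Some; apply: open_comp => // x _; exact: cf.
  by case: ifP => // _; exact: measurable_None.
apply/seteqP; split=> [[z Iz|/=]|[z|]].
- by left; exists z.
- by move=> /mem_set I0; right; rewrite I0.
- by case=> [[w Iw [<-]]//|]; case: ifP.
- by case=> [[]//|]; case: ifP => // /set_mem.
Qed.

Lemma open_box (k : nat) (a : R) :
  open [set z : E R | rval z.1 < a /\ z.2 = k].
Proof.
rewrite (_ : mkset _ = [set z : E R | Enorm z < a + k%:R] `&` (snd @^-1` [set k])).
  apply: openI.
    apply: (@open_comp _ _ Enorm [set r | r < a + k%:R]) => [z _|].
      exact: Enorm_continuous.
    exact: open_lt.
  apply: (@open_comp _ _ (snd : E R -> nat)) => [z _|]; last exact: discrete_open.
  exact: cvg_snd.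
apply/seteqP; split => -[x n] /= [] /[swap] -> h; split => //; move: h.
  by rewrite /Enorm/= ltrD2r.
by rewrite /Enorm/= ltrD2r.
Qed.

(* The half-open box [0, a) x {k}; it is empty for a <= 0. *)
Definition box (k : nat) (a : R) : set (ED R) :=
  Some @` [set z | rval z.1 < a /\ z.2 = k].

(** No box contains [None]; with [setT] in the system, total mass determines the mass of [None]. *)
Definition boxes : set (set (ED R)) :=
  [set A | A = setT \/ exists k a, A = box k a].

Lemma box_SomeE k a x n :
  box k a (Some (x, n)) = (rval x < a /\ n = k).
Proof.
apply/propext; split => [[[y m] /= h [<- <-]]//|h].
by exists (x, n).
Qed.

Lemma measurable_box k a : measurable (box k a : set (borel (ED R))).
Proof. by apply: open_Some; exact: open_box. Qed.

Lemma setI_closed_boxes : setI_closed boxes.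
Proof.
move=> A B [->|[k [a ->]]] [->|[l [b ->]]].
- by left; rewrite setTI.
- by right; exists l, b; rewrite setTI.
- by right; exists k, a; rewrite setIT.
(* Boxes over different levels are disjoint; the bound -1 yields the empty box. *)
- right; exists k, (if k == l then Num.min a b else -1).
  apply/seteqP; split => [[[x n]|] [] |[[x n]|]].
  + rewrite !box_SomeE => -[xa ->] [xb <-].
    by rewrite eqxx lt_min xa xb.
  + by case.
  + rewrite box_SomeE; case: eqP => [<-|_] [].
      by rewrite lt_min => /andP[? ?] ->; split; rewrite box_SomeE.
    by rewrite ltNge (le_trans _ (rval_ge0 x))// lerN10.
  + by case.
Qed.

Local Notation Sboxes := (g_sigma_algebraType boxes).

(** The value -1 marks every state off level k, [None] included, so that subsets of [0, oo) pull
    back into level k. *)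
Let coord (k : nat) (z : Sboxes) : R :=
  if z is Some (x, n) then (if n == k then rval x else -1) else -1.

Let measurable_coord k : measurable_fun setT (coord k).
Proof.
apply: (measurability _ (RGenInftyO.measurableE R)).
move=> _ [_ [a ->] <-]; rewrite setTI.
have mb l b : measurable (box l b : set Sboxes).
  by apply: sub_sigma_algebra; right; exists l, b.
have [a1|a1] := leP a (-1).
  rewrite (_ : _ @^-1` _ = set0)//; apply/seteqP; split => // -[[x n]|] /=.
    rewrite in_itv/=; case: ifP => _ h; last lra.
    by have := rval_ge0 x; lra.
  by rewrite in_itv/=; lra.
(* Once a > -1, the preimage contains all states off level k, and these form the complement of the
   union of the boxes over k. *)
rewrite (_ : _ @^-1` _ = ~` (\bigcup_N box k N%:R) `|` box k a).
  by apply: measurableU => //; apply: measurableC; exact: bigcup_measurable.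
apply/seteqP; split => -[[x n]|] /=.
- rewrite in_itv/=; case: eqP => [->|nk] xa.
    by right; rewrite box_SomeE.
  by left => -[N _]; rewrite box_SomeE => -[].
- by move=> _; left => -[N _ []].
- rewrite in_itv/=; case: eqP => [->|nk]//.
  case => [|]; last by rewrite box_SomeE => -[].
  move=> h; exfalso; apply: h; exists (Num.bound (rval x)) => //.
  rewrite box_SomeE; split=> //; exact: archi_boundP (rval_ge0 x).
- by move=> _; rewrite in_itv/=.
Qed.

(** The section of V at level k is pulled back to an open set of R by [to_Rplus]; intersecting with
    [0, oo) discards the marker -1, and [coord k] does the rest. *)
Let measurable_slice (V : set (E R)) k : open V ->
  boxes.-sigma.-measurable (Some @` (V `&` [set z | z.2 = k]) : set Sboxes).
Proof.
move=> oV.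
have oVk : open (@to_Rplus R @^-1` [set x | V (x, k)]).
  apply: open_comp => [x _|]; first exact: to_Rplus_continuous.
  rewrite (_ : [set x | _] = (fun x : Rplus R => (x, k) : E R) @^-1` V)//.
  apply: open_comp => // x _.
  by apply: (@section_continuous R (E R) id k) => // ?.
have := measurable_coord k; move=> /(_ measurableT
  (@to_Rplus R @^-1` [set x | V (x, k)] `&` `[0, +oo[%classic)).
rewrite setTI => /(_ _); set A := (X in (_ -> X) -> _).
suff -> : Some @` (V `&` [set z | z.2 = k]) = coord k @^-1`
    (@to_Rplus R @^-1` [set x | V (x, k)] `&` `[0, +oo[%classic).
  by apply; apply: measurableI => //; exact: open_measurable.
apply/seteqP; split => [[[x n]|] [[y m] /= [Vy mk] []]// <- <-|[[x n]|]] /=.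
- by rewrite mk eqxx rvalK -mk; split => //; rewrite in_itv/= rval_ge0.
- case: eqP => [->|_].
    by rewrite rvalK => -[Vx _]; exists (x, k).
  by rewrite in_itv/= => -[_]; rewrite andbT; lra.
- by rewrite in_itv/= => -[_]; rewrite andbT; lra.
Qed.

(** An open set is a countable union of its slices, together with its trace on [[set None]], which
    is empty or the complement of the image of E. *)
Lemma borel_ED_boxes :
  @measurable _ (borel (ED R)) = <<s boxes >>.
Proof.
apply/seteqP; split; apply: smallest_sub.
- exact: smallest_sigma_algebra.
- move=> U oU.
  have oV : open (Some @^-1` U : set (E R)).
    by apply: (@open_comp _ _ (Some : E R -> ED R)) => // z _; exact: one_point_compactification_some_continuous.
  have mS (V : set (E R)) : open V -> boxes.-sigma.-measurable (Some @` V : set Sboxes).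
    move=> oV'; rewrite (_ : _ @` V = \bigcup_k (Some @` (V `&` [set z | z.2 = k]))).
      by apply: bigcup_measurable => k _; exact: measurable_slice.
    apply/seteqP; split => [_ [z Vz <-]|_ [k _ [z [Vz _] <-]]]; last by exists z.
    by exists z.2 => //; exists z.
  have -> : U = Some @` (Some @^-1` U) `|` (U `&` ~` (Some @` [set: E R])).
    apply/seteqP; split => [[z Uz|UN]|z [[w Uw <-]//|[]//]].
      by left; exists z.
    by right; split => // -[].
  apply: (@measurableU _ Sboxes); first exact: mS.
  have [UN|UN] := pselect (U None).
    rewrite (_ : U `&` _ = ~` (Some @` [set: E R])).
      by apply: (@measurableC _ Sboxes); apply: mS; exact: openT.
    apply/seteqP; split => [z []//|[z|]]; last by split.
    by case; exists z.
  rewrite (_ : U `&` _ = set0); first exact: (@measurable0 _ Sboxes).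
  apply/seteqP; split => // -[z|] [//].
  by move=> _; case; exists z.
- exact: sigma_algebra_measurable.
- move=> _ [->|[k [a ->]]]; first exact: measurableT.
  exact: measurable_box.
Qed.

End borel_sets.

(** * C_0(E) and its integrals *)

Section C0_space.
Context {R : realType}.
Implicit Types f g : E R -> R.

Lemma C0_bounded f : C0 f -> exists M : R, forall z, `|f z| <= M.
Proof.
move=> [cf f0]; have [K [cK Kf]] := f0 1 ltr01.
have /compact_bounded [M [_ MK]] : compact (f @` K).
  by apply: continuous_compact => //; exact: continuous_subspaceT.
exists (Num.max (M + 1) 1) => z; have [Kz|nKz] := pselect (K z).
  have /(_ (f z)) /= := MK (M + 1) (ltr_pwDr ltr01 (lexx M)).
  by rewrite le_max => -> //; exists z.
by rewrite le_max (ltW (Kf _ nKz)) orbT.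
Qed.

Lemma C0_lin (a : R) f g : C0 f -> C0 g -> C0 (fun z => a * f z + g z).
Proof.
move=> /C0P[cf f0] /C0P[cg g0]; apply/C0P; split=> [n x|e e0].
  have cfx := cf n x; have cgx := cg n x.
  exact: (cvgD (cvgM (cvg_cst a) cfx) cgx).
have a1 : 0 < `|a| + 1 by rewrite ltr_wpDl.
have [M1 M1f] := f0 (e / (`|a| + 1) / 2) (divr_gt0 (divr_gt0 e0 a1) (ltr0Sn _ _)).
have [M2 M2g] := g0 (e / 2) (divr_gt0 e0 (ltr0Sn _ _)).
exists (Num.max M1 M2) => z; rewrite gt_max => /andP[/M1f fz /M2g gz].
rewrite (le_lt_trans (ler_normD _ _))// normrM.
have : `|a| * `|f z| <= (`|a| + 1) * (e / (`|a| + 1) / 2).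
  by rewrite ler_pM// ?lerDl// ltW.
rewrite mulrA mulrCA divff ?gt_eqF// mulr1 => h.
by rewrite [ltRHS](splitr e) ler_ltD.
Qed.

Lemma C0_0 : C0 (fun=> 0 : R).
Proof.
apply/C0P; split=> [n|e e0]; first exact: cst_continuous.
by exists 0 => z _; rewrite normr0.
Qed.

Lemma C0_scale (a : R) f : C0 f -> C0 (fun z => a * f z).
Proof.
move=> f0; rewrite (_ : (fun z => _) = fun z => a * f z + 0).
  exact: C0_lin f0 C0_0.
by apply/funext => z; rewrite addr0.
Qed.

Lemma C0_add f g : C0 f -> C0 g -> C0 (fun z => f z + g z).
Proof.
move=> f0 g0; rewrite (_ : (fun z => _) = fun z => 1 * f z + g z).
  exact: C0_lin.
by apply/funext => z; rewrite mul1r.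
Qed.

Lemma C0_sub f g : C0 f -> C0 g -> C0 (fun z => f z - g z).
Proof.
move=> f0 g0; rewrite (_ : (fun z => _) = fun z => -1 * g z + f z).
  exact: C0_lin.
by apply/funext => z; rewrite mulN1r addrC.
Qed.

Lemma C0_sum (I : Type) (s : seq I) (F : I -> E R -> R) :
  (forall i, C0 (F i)) -> C0 (fun z => \sum_(i <- s) F i z).
Proof.
move=> F0; elim: s => [|i s IH].
  rewrite (_ : (fun z => _) = fun=> 0); first exact: C0_0.
  by apply/funext => z; rewrite big_nil.
rewrite (_ : (fun z => _) = fun z => F i z + \sum_(i <- s) F i z).
  exact: C0_add.
by apply/funext => z; rewrite big_cons.
Qed.

Lemma sup_dist_le_sym f g (e : R) : sup_dist_le f g e -> sup_dist_le g f e.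
Proof. by move=> fg z; rewrite distrC. Qed.

Lemma sup_dist_le_trans f g h (a b : R) :
  sup_dist_le f g a -> sup_dist_le g h b -> sup_dist_le f h (a + b).
Proof. by move=> fg gh z; rewrite (le_trans (ler_distD (g z) _ _))// lerD. Qed.

(** Completeness of C_0(E) in the form used below: what holds on the dense span reaches C_0(E)
    through uniform limits. *)
Lemma C0_closed f :
  (forall e : R, 0 < e -> exists2 g, C0 g & sup_dist_le f g e) -> C0 f.
Proof.
move=> fg; apply/C0P; split=> [n x|e e0].
  apply/continuous_RplusP => e e0.
  have [g /C0P[cg _] fge] := fg (e / 4) (divr_gt0 e0 (ltr0Sn _ _)).
  have /continuous_RplusP /(_ (e / 4) (divr_gt0 e0 (ltr0Sn _ _)))[d d0 dg] := cg n x.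
  exists d => // y /dg h1; have h2 := fge (x, n); have h3 := fge (y, n).
  have := ler_normD (f (y, n) - g (y, n)) (g (y, n) - g (x, n)).
  have := ler_normD (f (y, n) - g (x, n)) (g (x, n) - f (x, n)).
  rewrite !addrA !subrK [`|g (x, n) - f _|]distrC; lra.
have [g /C0P[_ g0] fge] := fg (e / 4) (divr_gt0 e0 (ltr0Sn _ _)).
have [M Mg] := g0 (e / 4) (divr_gt0 e0 (ltr0Sn _ _)).
exists M => z /Mg gz; have := fge z; have := ler_normD (f z - g z) (g z).
rewrite subrK; lra.
Qed.

End C0_space.

(** * Integrals of C_0 functions and the laws they determine *)

Section mean.
Context {R : realType}.
Implicit Types (f g : E R -> R) (mu nu : probability (borel (ED R)) R).

Lemma C0_ext0_measurable f : C0 f ->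
  measurable_fun setT (ext0 f : borel (ED R) -> R).
Proof. by move=> [cf _]; exact: ext0_measurable. Qed.

Lemma C0_integrable mu f : C0 f ->
  mu.-integrable setT (EFin \o (ext0 f : borel (ED R) -> R)).
Proof.
move=> f0; apply: measurable_bounded_integrable => //.
- by rewrite [X in (X < _)%E](probability_setT mu) ltry.
- exact: C0_ext0_measurable.
- have [M Mf] := C0_bounded f0; exists M; split; first exact: num_real.
  move=> N MN [z|] _ /=; first by rewrite (le_trans (Mf _))// ltW.
  have z0 : E R := (Rplus0 R, 0%N).
  by rewrite normr0 (le_trans (normr_ge0 (f z0)))// (le_trans (Mf _))// ltW.
Qed.

Definition mean mu f : R := \int[mu]_w ext0 f w.

Lemma meanE mu f : C0 f -> (\int[mu]_w (ext0 f w)%:E)%E = (mean mu f)%:E.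
Proof.
by move=> f0; rewrite fineK//; apply: integrable_fin_num => //; exact: C0_integrable.
Qed.

Lemma mean_lin mu (a : R) f g : C0 f -> C0 g ->
  mean mu (fun z => a * f z + g z) = a * mean mu f + mean mu g.
Proof.
move=> f0 g0; have fi := C0_integrable mu f0; have gi := C0_integrable mu g0.
rewrite -RintegralZl// -RintegralD//.
- by apply: eq_Rintegral => -[z|] _ //=; rewrite mulr0 addr0.
- rewrite (_ : EFin \o _ = EFin \o (ext0 (fun z => a * f z) : borel (ED R) -> R)).
    by apply: C0_integrable; exact: C0_scale.
  by apply/funext => -[z|] //=; rewrite mulr0.
Qed.

Lemma mean_ge0 mu f : (forall z, 0 <= f z) -> 0 <= mean mu f.
Proof. by move=> f0; apply: Rintegral_ge0 => -[z|] _ /=. Qed.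

Lemma mean_le mu f (M : R) : C0 f -> (forall z, `|f z| <= M) -> `|mean mu f| <= M.
Proof.
move=> f0 fM; have M0 : 0 <= M.
  have z0 : E R := (Rplus0 R, 0%N).
  exact: le_trans (normr_ge0 _) (fM z0).
have fi := C0_integrable mu f0.
apply: (le_trans (le_normr_Rintegral measurableT fi)).
have -> : M = \int[mu]_w M.
  rewrite Rintegral_cst// -[LHS]mulr1; congr (_ * _).
  exact/esym/(congr1 fine (probability_setT mu)).
apply: le_Rintegral => //.
- exact: (integrable_norm fi).
- by apply: finite_measure_integrable_cst.
- by move=> [z|] _ /=; rewrite ?normr0.
Qed.

Lemma mean_sub mu f g : C0 f -> C0 g ->
  mean mu (fun z => f z - g z) = mean mu f - mean mu g.
Proof.
move=> f0 g0; rewrite (_ : (fun z => _) = fun z => -1 * g z + f z).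
  by rewrite mean_lin// mulN1r addrC.
by apply/funext => z; rewrite mulN1r addrC.
Qed.

Lemma mean_dist mu f g (e : R) : C0 f -> C0 g -> sup_dist_le f g e ->
  `|mean mu f - mean mu g| <= e.
Proof. by move=> f0 g0 fg; rewrite -mean_sub//; apply: mean_le => //; exact: C0_sub. Qed.

(** These ramps vanish from a onwards, equal 1 where n (a - x) >= 1, and increase with n to the
    indicator of [box k a]; the half-open shape of the box makes the limit exact. *)
Lemma C0_ramp (k n : nat) (a : R) :
  C0 (fun z : E R => if z.2 == k
    then Num.min 1 (n%:R * Num.max 0 (a - rval z.1)) else 0).
Proof.
apply/C0P; split=> [m x|e e0] /=.
  have [mk|mk] := eqVneq m k; last exact: cst_continuous.
  apply: (@continuous_comp _ _ _ (@rval R)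
    (fun r => Num.min 1 (n%:R * Num.max 0 (a - r)))).
    exact: rval_continuous.
  have cb : continuous_at (rval x) (fun r => a - r).
    by apply: cvgB; [exact: cvg_cst|exact: cvg_id].
  have cm : continuous_at (rval x) (fun r => n%:R * Num.max 0 (a - r)).
    apply: cvgM; first exact: cvg_cst.
    exact: (@continuous_max _ _ (fun=> 0) (fun r => a - r) _ (cvg_cst _) cb).
  exact: (@continuous_min _ _ (fun=> 1) (fun r => n%:R * Num.max 0 (a - r)) _ (cvg_cst _) cm).
exists (a + k%:R) => -[x m]; rewrite /Enorm/=.
case: eqP => [->|_ _]; last by rewrite normr0.
by rewrite ltrD2r => ax; rewrite max_l ?subr_le0 ?ltW// mulr0 minEle ler10 normr0.
Qed.

Lemma ramp_cvg (a y : R) : 0 < a - y ->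
  Num.min 1 (n%:R * Num.max 0 (a - y)) @[n --> \oo] --> (1 : R).
Proof.
move=> ay; apply: cvg_near_cst; near=> m.
have mb : (Num.bound (a - y)^-1 <= m)%N by near: m; exact: nbhs_infty_ge.
rewrite max_r ?ltW// min_l// -ler_pdivrMr// div1r.
apply: (le_trans (ltW (archi_boundP _))); first by rewrite invr_ge0 ltW.
by rewrite ler_nat.
Unshelve. all: by end_near. Qed.

Lemma mean_ramp_cvg mu k a :
  (mean mu (fun z : E R => if z.2 == k
     then Num.min 1 (n%:R * Num.max 0 (a - rval z.1)) else 0))%:E
    @[n --> \oo] --> mu (box k a).
Proof.
pose g n (w : borel (ED R)) := (ext0 (fun z : E R => if z.2 == k
     then Num.min 1 (n%:R * Num.max 0 (a - rval z.1)) else 0) w)%:E.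
have gE w : limn (g ^~ w) = (\1_(box k a) w)%:E.
  apply/cvg_lim => //; rewrite /g indicE; case: w => [[x m]|] /=; last first.
    by rewrite (_ : (None \in box k a) = false) ?memNset//; [exact: cvg_cst|case].
  rewrite (_ : (Some (x, m) \in box k a) = (rval x < a) && (m == k)); last first.
    apply/idP/andP; first by rewrite inE box_SomeE => -[? /eqP].
    by move=> [? /eqP ?]; rewrite inE box_SomeE.
  case: (m == k); rewrite ?andbF ?andbT/=; last exact: cvg_cst.
  apply: cvg_EFin; first by near=> n.
  have [xa|ax] := ltP (rval x) a; first by apply: (@ramp_cvg a (rval x)); rewrite subr_gt0.
  apply: cvg_near_cst; apply: nearW => n /=.
  by rewrite max_l ?subr_le0// mulr0 minEle ler10.
have := @cvg_monotone_convergence _ _ _ mu setT measurableT g.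
under eq_integral do rewrite gE.
rewrite integral_indic//; last exact: measurable_box.
rewrite setIT (_ : (fun n => \int[mu]_w g n w)%E = fun n => (mean mu (fun z : E R => if z.2 == k
     then Num.min 1 (n%:R * Num.max 0 (a - rval z.1)) else 0))%:E); last first.
  by apply/funext => n; rewrite meanE//; exact: C0_ramp.
apply.
- by move=> n; apply/measurable_EFinP; apply: C0_ext0_measurable; exact: C0_ramp.
- move=> n [[x m]|] _; rewrite /g lee_fin//=; case: ifP => // _.
  by rewrite le_min ler01 mulr_ge0// le_max lexx.
- move=> [[x m]|] _ i j ij; rewrite /g lee_fin//=; case: ifP => // _.
  rewrite le_min ge_min lexx/= ge_min; apply/orP; right.
  by rewrite ler_wpM2r ?ler_nat// le_max lexx.
Unshelve. all: by end_near. Qed.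

(** Monotone limits of ramps give agreement on the boxes, total mass gives agreement on [setT], and
    these sets form a generating system stable under intersection. *)
Lemma mean_unique mu nu : (forall f, C0 f -> mean mu f = mean nu f) ->
  forall A, measurable A -> mu A = nu A.
Proof.
move=> mn; apply: (@measure_unique _ R (borel (ED R)) boxes (fun=> setT) _ _ _ _ mu nu) => //.
- exact: borel_ED_boxes.
- exact: setI_closed_boxes.
- by move=> _; left.
- by rewrite bigcup_const//; exists 0%N.
- move=> _ [->|[k [a ->]]]; first exact: etrans (probability_setT mu) (esym (probability_setT nu)).
  have h1 := @mean_ramp_cvg mu k a; have h2 := @mean_ramp_cvg nu k a.
  apply: (cvg_unique (@ereal_hausdorff R) h1).
  rewrite (_ : (fun n => _) = (fun n : nat => (mean nu (fun z : E R => if z.2 == k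
     then Num.min 1 (n%:R * Num.max 0 (a - rval z.1)) else 0))%:E))//.
  by apply/funext => n; congr EFin; apply: mn; exact: C0_ramp.
- by move=> _; rewrite [X in (X < _)%E](probability_setT mu) ltry.
Qed.

End mean.

(** * Density of the exponentials *)

Section bernstein.
Context {R : realType}.

(* The Bernstein operator sum_i phi(i) C(n,i) s^i (1-s)^(n-i), through the
   one-step recursion for the binomial law. *)
Fixpoint bernstein (n : nat) (phi : nat -> R) (s : R) : R :=
  if n is m.+1 then
    s * bernstein m (fun i => phi i.+1) s + (1 - s) * bernstein m phi s
  else phi 0%N.

(** The binomial weights sum to 1. *)
Lemma bernstein_affine n (a c s : R) (phi : nat -> R) :
  bernstein n (fun i => c + a * phi i) s = c + a * bernstein n phi s.
Proof.
elim: n phi => [|n IH] phi //=.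
by rewrite (IH (fun i => phi i.+1)) IH; ring.
Qed.

Lemma bernstein_le n (s : R) (phi psi : nat -> R) : 0 <= s <= 1 ->
  (forall i, (i <= n)%N -> phi i <= psi i) ->
  bernstein n phi s <= bernstein n psi s.
Proof.
move=> /andP[s0 s1]; elim: n phi psi => [|n IH] phi psi h /=; first exact: h.
by rewrite lerD// ler_wpM2l ?subr_ge0// IH// => i ?; apply: h; rewrite // leqW.
Qed.

(** Squared bias plus variance of the binomial law with parameters n and s. The centre a stays free
    because the recursion shifts it to a - 1. *)
Lemma bernstein_sqr n (a s : R) :
  bernstein n (fun i => (i%:R - a) ^+ 2) s =
  (n%:R * s - a) ^+ 2 + n%:R * s * (1 - s).
Proof.
elim: n a => [|n IH] a /=; first by ring.
rewrite [X in _ * X + _](_ : _ = bernstein n (fun i => (i%:R - (a - 1)) ^+ 2) s).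
  by rewrite !IH -natr1; ring.
by congr (bernstein n _ s); apply/funext => i; rewrite -natr1; congr (_ ^+ 2); ring.
Qed.

(* Compactness absorbs the modulus of continuity into a quadratic term. *)
Lemma continuous_quadratic_modulus (h : R -> R) (e : R) : 0 < e ->
  (forall s : R, 0 <= s <= 1 -> continuous_at s h) ->
  exists2 K : R, 0 <= K & forall s t : R, 0 <= s <= 1 -> 0 <= t <= 1 ->
    `|h s - h t| <= e + K * (s - t) ^+ 2.
Proof.
move=> e0 ch.
have [M Mh] : exists M : R, forall s : R, 0 <= s <= 1 -> `|h s| <= M.
  have /compact_bounded [M [_ MK]] : compact (h @` `[0, 1]).
    apply: continuous_compact; last exact: segment_compact.
    apply: continuous_in_subspaceT => s; rewrite inE /= in_itv /= => s01.
    exact: ch.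
  exists (M + 1) => s s01; have /(_ (h s)) /= := MK (M + 1) (ltr_pwDr ltr01 (lexx M)).
  by apply; exists s => //=; rewrite in_itv.
have M0 : 0 <= M by apply: le_trans (normr_ge0 _) (Mh 0 _); rewrite lexx ler01.
pose P (K s : R) := 0 <= s <= 1 -> forall t : R, 0 <= t <= 1 ->
  `|h s - h t| <= e + K * (s - t) ^+ 2.
suff [K [_ KP]] : \forall K \near +oo, `[0, 1]%classic `<=` P K.
  exists (Num.max 0 (K + 1)); first by rewrite le_max lexx.
  move=> s t s01 t01.
  have : P (K + 1) s by apply: KP; rewrite ?ltrDl//= in_itv.
  move=> /(_ s01 t t01) /le_trans; apply; rewrite lerD2l ler_wpM2r ?sqr_ge0//.
  by rewrite le_max lexx orbT.
have /compact_near_coveringP := @segment_compact R 0 1; apply.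
move=> x /=; rewrite in_itv/= => x01.
have /cvgrPdist_lt/(_ (e / 2)) := ch x x01; rewrite divr_gt0// => /(_ isT).
move=> /nbhs_ballP[d /= d0 dh].
(* For s in this ball, either t is d-close to x and continuity at x suffices, or |s - t| >= d/2 and
   K (d/2)^2 >= 2 M dominates any difference of values of h. The covering form of compactness then
   yields one K for all s. *)
exists (ball x (d / 2), [set K | 2 * M * 4 / d ^+ 2 <= K]).
  split => /=; first by apply: nbhsx_ballx; rewrite divr_gt0.
  by apply: nbhs_pinfty_ge; exact: num_real.
move=> [s K] [/= xs MK] s01 t t01; rewrite /ball /= in xs.
have K0 : 0 <= K.
  by apply: le_trans MK; rewrite divr_ge0 ?sqr_ge0// mulr_ge0// mulr_ge0.
have [xt|xt] := ltP `|x - t| d.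
  have /dh hs : ball x d s by rewrite /ball /= (lt_le_trans xs)// ler_pdivrMr// ler_peMr ?ler1n// ltW.
  have /dh ht : ball x d t by [].
  have := ler_distD (h x) (h s) (h t); rewrite [`|h s - h x|]distrC.
  have := mulr_ge0 K0 (sqr_ge0 (s - t)); move: hs ht => /=; lra.
have st : (d / 2) ^+ 2 <= (s - t) ^+ 2.
  rewrite -[leRHS]real_normK ?num_real// ler_pXn2r// ?nnegrE ?divr_ge0 ?(ltW d0)//.
  by have := ler_distD s x t; lra.
have : 2 * M <= K * (s - t) ^+ 2.
  apply: le_trans (ler_pM _ _ MK st); rewrite ?sqr_ge0// ?divr_ge0 ?sqr_ge0 ?mulr_ge0//.
  by rewrite [leRHS](_ : _ = 2 * M)//; field; rewrite gt_eqF.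
by have := ler_normB (h s) (h t); have := Mh s s01; have := Mh t t01; lra.
Qed.

(** Averaging the quadratic modulus over the binomial law turns (s - i/n)^2 into the variance s (1 -
    s) / n, so the error is at most e/2 + K/n; n makes the last term at most e/2. *)
Lemma bernstein_dense (h : R -> R) (e : R) : 0 < e ->
  (forall s : R, 0 <= s <= 1 -> continuous_at s h) ->
  exists n, forall s : R, 0 <= s <= 1 ->
    `|h s - bernstein n (fun i => h (i%:R / n%:R)) s| <= e.
Proof.
move=> e0 ch; have e20 : 0 < e / 2 by rewrite divr_gt0.
have [K K0 Kh] := continuous_quadratic_modulus e20 ch.
pose n := (Num.bound (K / (e / 2))).+1; exists n => s s01.
have n0 : 0 < n%:R :> R by rewrite ltr0n.
have Kn : K / n%:R <= e / 2.
  rewrite ler_pdivrMr// mulrC -ler_pdivrMr// ltW//.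
  apply: lt_trans (archi_boundP _) _; first by rewrite divr_ge0// ltW.
  by rewrite ltr_nat.
have i01 i : (i <= n)%N -> 0 <= (i%:R / n%:R : R) <= 1.
  by move=> i_n; rewrite divr_ge0//= ler_pdivrMr// mul1r ler_nat.
have key c a : c + a * ((n%:R * s - n%:R * s) ^+ 2 + n%:R * s * (1 - s)) =
    bernstein n (fun i => c + a * (i%:R - n%:R * s) ^+ 2) s.
  by rewrite bernstein_affine bernstein_sqr.
have sq (i : nat) : (s - i%:R / n%:R) ^+ 2 = (n%:R ^- 2) * (i%:R - n%:R * s) ^+ 2.
  by field; rewrite gt_eqF.
have ss : K * (n%:R ^- 2) * (n%:R * s * (1 - s)) <= e / 2.
  apply: le_trans Kn.
  rewrite (_ : _ * _ = K / n%:R * (s * (1 - s))); last by field; rewrite gt_eqF.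
  rewrite ler_piMr ?divr_ge0 ?(ltW n0)//.
  by case/andP: s01 => s0 s1; rewrite mulr_ile1 ?subr_ge0// lerBlDr lerDl.
have up : bernstein n (fun i => h (i%:R / n%:R)) s <= h s + e.
  apply: (@le_trans _ _ (bernstein n (fun i => (h s + e / 2) + (K * n%:R ^- 2) * (i%:R - n%:R * s) ^+ 2) s)).
    apply: bernstein_le => // i i_n; rewrite -mulrA -sq.
    by have := Kh _ _ s01 (i01 i i_n); rewrite ler_distlC; lra.
  by rewrite -key subrr; lra.
have lo : h s - e <= bernstein n (fun i => h (i%:R / n%:R)) s.
  apply: (@le_trans _ _ (bernstein n (fun i => (h s - e / 2) + (- (K * n%:R ^- 2)) * (i%:R - n%:R * s) ^+ 2) s)).
    by rewrite -key subrr; lra.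
  apply: bernstein_le => // i i_n; rewrite mulNr -mulrA -sq.
  by have := Kh _ _ s01 (i01 i i_n); rewrite ler_distlC; lra.
by rewrite ler_distlC; apply/andP; split; lra.
Qed.

End bernstein.

(** * Uniform density of the span of the exponentials in C_0(E) *)

Section density.
Context {R : realType}.
Implicit Types (f g : E R -> R) (q r : R).

Lemma span_fqr_lin (a : R) f g :
  span_fqr f -> span_fqr g -> span_fqr (fun z => a * f z + g z).
Proof.
move=> [n [c [q [r [qr ->]]]]] [m [c' [q' [r' [qr' ->]]]]].
exists (n + m)%N.
exists (fun i : 'I_(n + m) => match fintype.split i with inl j => a * c j | inr j => c' j end).
exists (fun i : 'I_(n + m) => match fintype.split i with inl j => q j | inr j => q' j end).
exists (fun i : 'I_(n + m) => match fintype.split i with inl j => r j | inr j => r' j end).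
split=> [i|]; first by case: (fintype.split i).
apply/funext => z; rewrite big_split_ord/= mulr_sumr; congr (_ + _).
  apply: eq_bigr => i _; rewrite mulrA.
  by case: splitP => j /= => [/val_inj <-//|ij]; have := ltn_ord i; rewrite ij ltnNge leq_addr.
apply: eq_bigr => i _.
case: splitP => j /= => [ij|/addnI/val_inj <-//].
by have := ltn_ord j; rewrite -ij ltnNge leq_addr.
Qed.

Lemma span_fqr0 : span_fqr (fun=> 0 : R).
Proof.
exists 0%N, (fun=> 0), (fun=> 0), (fun=> 0); split; first by case.
by apply/funext => z; rewrite big_ord0.
Qed.

Lemma span_fqr_fqr q r : 0 < q -> 0 < r < 1 -> span_fqr (fqr q r).
Proof.
move=> q0 r01; exists 1%N, (fun=> 1), (fun=> q), (fun=> r); split=> //.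
by apply/funext => z; rewrite big_ord_recl big_ord0 mul1r addr0.
Qed.

Definition fqr_limit f : Prop :=
  forall e : R, 0 < e -> exists2 h, span_fqr h & sup_dist_le f h e.

Lemma fqr_limit_span f : span_fqr f -> fqr_limit f.
Proof. by move=> sf e e0; exists f => // z; rewrite subrr normr0 ltW. Qed.

Lemma fqr_limit_lin (a : R) f g : fqr_limit f -> fqr_limit g ->
  fqr_limit (fun z => a * f z + g z).
Proof.
move=> lf lg e e0; have a1 : 0 < `|a| + 1 by rewrite ltr_wpDl.
have [f' sf ff'] := lf (e / 2 / (`|a| + 1)) (divr_gt0 (divr_gt0 e0 (ltr0Sn _ _)) a1).
have [g' sg gg'] := lg (e / 2) (divr_gt0 e0 (ltr0Sn _ _)).
exists (fun z => a * f' z + g' z); first exact: span_fqr_lin.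
move=> z; rewrite opprD addrACA -mulrBr [leRHS]splitr.
rewrite (le_trans (ler_normD _ _))// lerD// normrM.
apply: (@le_trans _ _ ((`|a| + 1) * (e / 2 / (`|a| + 1)))).
  by rewrite ler_pM// lerDl.
by rewrite mulrCA divff ?gt_eqF// mulr1.
Qed.

Lemma fqr_limit_closed f :
  (forall e : R, 0 < e -> exists2 h, fqr_limit h & sup_dist_le f h e) ->
  fqr_limit f.
Proof.
move=> lf e e0; have e20 : 0 < e / 2 by rewrite divr_gt0.
have [h /(_ _ e20)[h' sh' hh'] fh] := lf _ e20.
by exists h' => //; rewrite [e]splitr; exact: sup_dist_le_trans fh hh'.
Qed.

Lemma fqr_limit_sum (n : nat) (c : nat -> R) (F : nat -> E R -> R) :
  (forall i, (i < n)%N -> fqr_limit (F i)) ->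
  fqr_limit (fun z => \sum_(i < n) c i * F i z).
Proof.
elim: n => [|n IH] lF.
  rewrite (_ : (fun z => _) = fun=> 0).
    exact/fqr_limit_span/span_fqr0.
  by apply/funext => z; rewrite big_ord0.
rewrite (_ : (fun z => _) = fun z => c n * F n z + \sum_(i < n) c i * F i z).
  by apply: fqr_limit_lin; [exact: lF|apply: IH => i i_n; apply: lF; rewrite ltnW].
by apply/funext => z; rewrite big_ord_recr/= addrC.
Qed.

(* The level indicator [m = k] is the uniform limit of
   r^-k (r^m - sum_(j < k) r^j [m = j]) as r goes to 0. *)
Lemma fqr_limit_level q (k : nat) : 0 < q ->
  fqr_limit (fun z => expR (- (q * rval z.1)) * (z.2 == k)%:R).
Proof.
move=> q0; elim/ltn_ind: k => k IH; apply: fqr_limit_closed => e e0.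
(* The error vanishes at levels m <= k and is at most r^(m - k) <= r <= e above; the cap 1/2 keeps r
   below 1. *)
pose r := Num.min e (1 / 2).
have r0 : 0 < r by rewrite lt_min e0 divr_gt0.
have r1 : r < 1 by rewrite gt_min; apply/orP; right; lra.
pose L z := \sum_(j < k) r ^+ j * (expR (- (q * rval (z : E R).1)) * (z.2 == j)%:R).
have Ll : fqr_limit L by apply: (@fqr_limit_sum k (fun j => r ^+ j) (fun j z => expR (- (q * rval z.1)) * (z.2 == j)%:R)) => j jk; exact: IH.
exists (fun z => (- (r ^- k)) * L z + (r ^- k * fqr q r z + 0)).
  apply: fqr_limit_lin => //; apply: fqr_limit_lin; apply: fqr_limit_span.
    by apply: span_fqr_fqr => //; rewrite r0.
  exact: span_fqr0.
move=> [x m]; rewrite /L /fqr /= addr0 mulNr.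
set E := expR _; have E01 : 0 <= E <= 1.
  rewrite expR_ge0/= -expR0 ler_expR oppr_le0 mulr_ge0 ?rval_ge0//.
  exact: ltW.
have Lm : \sum_(j < k) r ^+ j * (E * (m == j)%:R) = if (m < k)%N then r ^+ m * E else 0.
  case: ifP => mk.
    rewrite (bigD1 (Ordinal mk))//= eqxx mulr1 big1 ?addr0// => j jm.
    rewrite (_ : (m == j) = false) ?mulr0//.
    by apply: contraNF jm => /eqP mj; apply/eqP/val_inj.
  by rewrite big1// => j _; case: eqP => [mj|]; rewrite ?mulr0//; have := ltn_ord j; rewrite -mj mk.
rewrite Lm; case: ltngtP => mk.
- rewrite mulr0 sub0r opprD opprK.
  by rewrite [E * _]mulrC subrr normr0 ltW.
- rewrite !mulr0 oppr0 !add0r normrN ger0_norm; last first.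
    by rewrite !mulr_ge0// ?invr_ge0 ?exprn_ge0 ?(ltW r0)//; case/andP: E01.
  have -> : r ^- k * (E * r ^+ m) = E * r ^+ (m - k).
    rewrite -{1}(subnK (ltnW mk)) exprD; field.
    by rewrite expf_neq0// gt_eqF.
  have : r ^+ (m - k) <= r.
    rewrite -[leRHS]expr1 ler_wiXn2l ?subn_gt0// ?(ltW r0)// ltW//.
  move=> rr; apply: (@le_trans _ _ (1 * r)).
    by case/andP: E01 => E0 E1; apply: ler_pM => //; rewrite exprn_ge0// ltW.
  by rewrite mul1r ge_min lexx.
- by rewrite mk mulr0 oppr0 add0r mulrA [_ * E]mulrC mulfVK ?subrr ?normr0 ?expf_neq0 ?gt_eqF// mulr1 subrr normr0 ltW.
Qed.

(** With s = e^{-x}, the factor s^(i+1) gives every monomial a positive exponent q, so no condition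
    on [phi] is required and the recursion on n closes. *)
Lemma fqr_limit_bernstein_pos (k n i : nat) (phi : nat -> R) :
  fqr_limit (fun z => expR (- rval z.1) ^+ i.+1 * bernstein n phi (expR (- rval z.1))
    * (z.2 == k)%:R).
Proof.
elim: n phi i => [|n IH] phi i /=.
  rewrite (_ : (fun z => _) = fun z : E R =>
      phi 0%N * (expR (- (i.+1%:R * rval z.1)) * (z.2 == k)%:R) + 0).
    apply: fqr_limit_lin; first by apply: fqr_limit_level; rewrite ltr0n.
    exact/fqr_limit_span/span_fqr0.
  apply/funext => z; rewrite addr0 -expRM_natl mulrN.
  by rewrite mulrA [phi _ * _]mulrC.
rewrite (_ : (fun z => _) = fun z : E R =>
    1 * (expR (- rval z.1) ^+ i.+2 * bernstein n (fun j => phi j.+1) (expR (- rval z.1))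
      * (z.2 == k)%:R)
    + ((-1) * (expR (- rval z.1) ^+ i.+2 * bernstein n phi (expR (- rval z.1))
      * (z.2 == k)%:R)
    + expR (- rval z.1) ^+ i.+1 * bernstein n phi (expR (- rval z.1))
      * (z.2 == k)%:R)).
  by apply: fqr_limit_lin => //; exact: fqr_limit_lin.
by apply/funext => z; rewrite [_ ^+ i.+2]exprS; ring.
Qed.

(** The condition at 0 removes the constant monomial, which would correspond to q = 0. In the
    recursion, all terms but [bernstein n phi] carry a factor s. *)
Lemma fqr_limit_bernstein (k n : nat) (phi : nat -> R) : phi 0%N = 0 ->
  fqr_limit (fun z => bernstein n phi (expR (- rval z.1)) * (z.2 == k)%:R).
Proof.
move=> phi0; elim: n => [|n IH] /=.
  rewrite (_ : (fun z => _) = fun=> 0); first exact/fqr_limit_span/span_fqr0.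
  by apply/funext => z; rewrite phi0 mul0r.
rewrite (_ : (fun z => _) = fun z : E R =>
    1 * (expR (- rval z.1) ^+ 1 * bernstein n (fun j => phi j.+1) (expR (- rval z.1))
      * (z.2 == k)%:R)
    + ((-1) * (expR (- rval z.1) ^+ 1 * bernstein n phi (expR (- rval z.1))
      * (z.2 == k)%:R)
    + bernstein n phi (expR (- rval z.1)) * (z.2 == k)%:R)).
  apply: fqr_limit_lin; first exact: fqr_limit_bernstein_pos.
  by apply: fqr_limit_lin => //; exact: fqr_limit_bernstein_pos.
by apply/funext => z; rewrite expr1; ring.
Qed.

(** The substitution s = e^{-x} compactifies the half-line to [0, 1], and decay of g becomes
    continuity at s = 0 with value 0. *)
Lemma fqr_limit_section (k : nat) (g : Rplus R -> R) : continuous g ->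
  (forall e : R, 0 < e -> exists M : R, forall x, M < rval x -> `|g x| < e) ->
  fqr_limit (fun z => g z.1 * (z.2 == k)%:R).
Proof.
move=> cg g0; apply: fqr_limit_closed => e e0.
(* The default 0 is the value at x = oo. For s > 1 the clamp in [to_Rplus] makes h constant, hence
   continuous from both sides at s = 1. *)
pose h (s : R) := if s <= 0 then 0 else g (to_Rplus (- ln s)).
have ch (s : R) : 0 <= s <= 1 -> continuous_at s h.
  move=> /andP[s0 _]; have [sp|sn] := ltP 0 s.
    have cs : continuous_at s (fun t => g (to_Rplus (- ln t))).
      apply: (@continuous_comp _ _ _ (fun t => to_Rplus (- ln t)) g); last exact: cg.
      apply: (@continuous_comp _ _ _ (fun t : R => - ln t) (@to_Rplus R)).
        by apply: cvgN; exact: continuous_ln.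
      exact: to_Rplus_continuous.
    rewrite /continuous_at {2}/h leNgt sp /=.
    apply: cvg_trans cs; apply: near_eq_cvg; near=> t.
    by rewrite /h leNgt (_ : 0 < t)//; near: t; exact: lt_nbhsr.
  have -> : s = 0 by apply/eqP; rewrite eq_le sn.
  rewrite /continuous_at {2}/h lexx; apply/cvgrPdist_lt => eps eps0.
  have [M gM] := g0 eps eps0.
  exists (expR (- M)) => /=; first exact: expR_gt0.
  move=> t /=; rewrite !sub0r !normrN /h => tM.
  have [t0|t0] := leP t 0; first by rewrite normr0.
  apply: gM; apply: (@lt_le_trans _ _ (- ln t)); last first.
    by rewrite rval_to_Rplus le_max lexx orbT.
  by rewrite ltrNr -ltr_expR lnK// (le_lt_trans (ler_norm _)).
have [n hn] := bernstein_dense e0 ch.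
exists (fun z => bernstein n (fun i => h (i%:R / n%:R)) (expR (- rval z.1)) * (z.2 == k)%:R).
  by apply: fqr_limit_bernstein; rewrite mul0r /h lexx.
move=> [x m] /=; rewrite -mulrBl normrM.
have -> : g x = h (expR (- rval x)).
  by rewrite /h leNgt expR_gt0 /= expRK opprK rvalK.
rewrite -[leRHS]mulr1 ler_pM//; last by case: (m == k); rewrite /= ?normr1 ?normr0.
apply: hn; rewrite expR_ge0/= -expR0 ler_expR oppr_le0 rval_ge0.
Unshelve. all: by end_near. Qed.

(** Above level N one has [Enorm] > M, so f is within e of the finite sum of its sections below N,
    each of which is a limit. *)
Lemma span_fqr_dense f : C0 f -> fqr_limit f.
Proof.
move=> /C0P[cf f0]; apply: fqr_limit_closed => e e0.
have [M Mf] := f0 e e0; pose N := (Num.truncn M).+1.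
exists (fun z : E R => \sum_(k < N) 1 * (f (z.1, val k) * (z.2 == k)%:R)).
  apply: (@fqr_limit_sum N (fun=> 1) (fun k z => f (z.1, k) * (z.2 == k)%:R)).
  move=> k _; apply: (@fqr_limit_section k (fun x => f (x, k))) => // eps eps0.
  have [M' Mf'] := f0 eps eps0; exists M' => x Mx; apply: Mf'.
  by rewrite (lt_le_trans Mx)// lerDl.
move=> [x m] /=.
have -> : \sum_(k < N) 1 * (f (x, val k) * (m == k)%:R) = if (m < N)%N then f (x, m) else 0.
  case: ifP => mk.
    rewrite (bigD1 (Ordinal mk))//= eqxx mulr1 mul1r big1 ?addr0// => j jm.
    rewrite (_ : (m == j) = false) ?mulr0//.
    by apply: contraNF jm => /eqP mj; apply/eqP/val_inj.
  by rewrite big1// => j _; case: eqP => [mj|]; rewrite ?mulr0//; have := ltn_ord j; rewrite -mj mk.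
case: ltnP => mN; first by rewrite subrr normr0 ltW.
rewrite subr0 ltW//; apply: Mf; rewrite /Enorm/=.
apply: lt_le_trans (truncnS_gt M) _; rewrite (@le_trans _ _ m%:R) ?ler_nat//.
by rewrite lerDr rval_ge0.
Qed.

End density.

(** * Generators and cores of Feller semigroups *)

Section semigroups.
Context {R : realType}.
Variable T : Rplus R -> (E R -> R) -> (E R -> R).
Hypothesis fT : is_feller T.
Implicit Types (f g h : E R -> R) (t s : Rplus R).

Let T_C0 t f : C0 f -> C0 (T t f).
Proof. by case: fT => h _ _ _ _; exact: h. Qed.

Let T_lin t (a : R) f g : C0 f -> C0 g ->
  T t (fun z => a * f z + g z) = (fun z => a * T t f z + T t g z).
Proof. by case: fT => _ h _ _ _; exact: h. Qed.

Let T0 f : C0 f -> T (Rplus0 R) f = f.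
Proof. by case: fT => _ _ [h _] _ _; exact: h. Qed.

Let TD s t f : C0 f -> T (addRplus s t) f = T s (T t f).
Proof. by case: fT => _ _ [_ h] _ _; exact: h. Qed.

Let T_le t f (M : R) : C0 f -> (forall z, `|f z| <= M) -> forall z, `|T t f z| <= M.
Proof. by case: fT => _ _ _ [_ h] _; exact: h. Qed.

Let T_cont f (e : R) : C0 f -> 0 < e ->
  exists2 d : R, 0 < d & forall t, rval t < d -> sup_dist_le (T t f) f e.
Proof. by case: fT => _ _ _ _ h f0 e0; apply/near_Rplus0P; exact: h. Qed.

Lemma semigroup_sub t f g : C0 f -> C0 g ->
  T t (fun z => f z - g z) = (fun z => T t f z - T t g z).
Proof.
move=> f0 g0; rewrite (_ : (fun z => f z - g z) = fun z => -1 * g z + f z).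
  by rewrite T_lin//; apply/funext => z; rewrite mulN1r addrC.
by apply/funext => z; rewrite mulN1r addrC.
Qed.

Lemma semigroup_dist t f g (e : R) : C0 f -> C0 g -> sup_dist_le f g e ->
  sup_dist_le (T t f) (T t g) e.
Proof.
move=> f0 g0 fg z.
by have := @T_le t _ e (C0_sub f0 g0) fg z; rewrite semigroup_sub.
Qed.

Fixpoint Rplus_natmul (h : Rplus R) (n : nat) : Rplus R :=
  if n is m.+1 then addRplus (Rplus_natmul h m) h else Rplus0 R.

Lemma rval_natmul (h : Rplus R) n : rval (Rplus_natmul h n) = n%:R * rval h.
Proof.
elim: n => [|n IH] /=; first by rewrite mul0r.
by rewrite rval_add IH -natr1 mulrDl mul1r.
Qed.

Lemma addRplusC s t : addRplus s t = addRplus t s.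
Proof. by apply: rval_inj; rewrite !rval_add addrC. Qed.

(* Telescoping T_(t) f - f over steps of length t / n, n -> oo, replaces the
   integral formula T_t f - f = int_0^t T_s g ds. *)
Lemma generator_increment f g t (S : R) : generator T f g ->
  (forall s, rval s <= rval t -> sup_dist_le (T s g) g S) ->
  forall z, `|T t f z - f z - rval t * g z| <= rval t * S.
Proof.
move=> [f0 g0 gen] hS z; have [t0|t0] := leP (rval t) 0.
  have -> : t = Rplus0 R by apply: rval_inj; apply/eqP; rewrite eq_le t0 rval_ge0.
  by rewrite T0// rval0 !mul0r !subr0 subrr normr0.
apply/ler_addgt0Pr => e e0; pose eta := e / rval t.
have eta0 : 0 < eta by rewrite divr_gt0.
have /near_dRplus0P[d d0 hd] := gen eta eta0.
pose n := (Num.bound (rval t / d)).+1.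
have n0 : 0 < n%:R :> R by rewrite ltr0n.
pose h := to_Rplus (rval t / n%:R : R).
have rh : rval h = rval t / n%:R by rewrite to_RplusK// divr_ge0 ?rval_ge0// ltW.
have rh0 : 0 < rval h by rewrite rh divr_gt0.
have rhd : rval h < d.
  rewrite rh ltr_pdivrMr// mulrC -ltr_pdivrMr//.
  apply: lt_trans (archi_boundP _) _; first by rewrite divr_ge0 ?(ltW d0) ?rval_ge0.
  by rewrite ltr_nat.
have step y : `|T h f y - (rval h * g y + f y)| <= rval h * eta.
  have := hd h; rewrite rh0 rhd => /(_ isT y).
  rewrite -(ler_pM2l rh0) -{1}(gtr0_norm rh0) -normrM mulrBr.
  by rewrite [rval h * (_ / _)]mulrC divfK ?gt_eqF// opprD addrA addrAC.
(* Each step of length h adds h eta from the difference quotient, transported by a contraction, and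
   h S from replacing T_(kh) g by g. *)
have claim k : (k <= n)%N ->
    `|T (Rplus_natmul h k) f z - f z - k%:R * rval h * g z| <= k%:R * rval h * (S + eta).
  elim: k => [_|k IH kn]; first by rewrite /= T0// !mul0r subr0 subrr normr0.
  have tk : rval (Rplus_natmul h k) <= rval t.
    rewrite rval_natmul rh mulrCA ler_piMr ?rval_ge0// ler_pdivrMr// mul1r.
    by rewrite ler_nat ltnW.
  have h1 := IH (ltnW kn); have h2 := hS _ tk z.
  have h3 := @semigroup_dist (Rplus_natmul h k) _ _ _ (T_C0 h f0) (C0_lin (rval h) g0 f0) step z.
  rewrite T_lin// in h3; rewrite [Rplus_natmul h k.+1]/= TD//.
  move: h1 h2 h3; set a := T _ (T _ _) z; set b := T _ g z; set c := T _ f z => h1 h2 h3.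
  have h2' : `|rval h * b - rval h * g z| <= rval h * S.
    by rewrite -mulrBr normrM gtr0_norm// ler_pM2l.
  rewrite -natr1 !mulrDl !mul1r.
  move: h1 h2' h3; rewrite !ler_norml.
  move=> /andP[? ?] /andP[? ?] /andP[? ?]; apply/andP; split; lra.
have := claim n (leqnn _).
have nh : n%:R * rval h = rval t by rewrite rh mulrCA divff ?mulr1// gt_eqF.
have -> : Rplus_natmul h n = t by apply: rval_inj; rewrite rval_natmul.
by rewrite nh mulrDr /eta [rval t * (e / _)]mulrC divfK ?gt_eqF.
Qed.

Lemma generator_lin (a : R) f g f' g' : generator T f g -> generator T f' g' ->
  generator T (fun z => a * f z + f' z) (fun z => a * g z + g' z).
Proof.
move=> [f0 g0 gen] [f'0 g'0 gen']; split; [exact: C0_lin|exact: C0_lin|].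
move=> e e0; have a1 : 0 < `|a| + 1 by rewrite ltr_wpDl.
have e20 : 0 < e / 2 by rewrite divr_gt0.
have /near_dRplus0P[d d0 hd] := gen (e / 2 / (`|a| + 1)) (divr_gt0 e20 a1).
have /near_dRplus0P[d' d'0 hd'] := gen' (e / 2) e20.
apply/near_dRplus0P; exists (Num.min d d'); first by rewrite lt_min d0.
move=> t /andP[t0]; rewrite lt_min => /andP[td td'] z.
have := hd t; rewrite t0 td => /(_ isT z).
have := hd' t; rewrite t0 td' => /(_ isT z) /= h' h.
rewrite T_lin//.
rewrite (_ : _ - _ = a * ((T t f z - f z) / rval t - g z) + ((T t f' z - f' z) / rval t - g' z)); last ring.
rewrite (le_trans (ler_normD _ _))// [leRHS]splitr lerD// normrM.
apply: (@le_trans _ _ ((`|a| + 1) * (e / 2 / (`|a| + 1)))).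
  by rewrite ler_pM// lerDl.
by rewrite mulrCA divff ?gt_eqF// mulr1.
Qed.

(** [T t] commutes with [T s] and is a contraction, so it carries the convergence of the difference
    quotients. *)
Lemma generator_semigroup t f g : generator T f g -> generator T (T t f) (T t g).
Proof.
move=> [f0 g0 gen]; split; [exact: T_C0|exact: T_C0|].
move=> e /gen/near_dRplus0P[d d0 hd]; apply/near_dRplus0P; exists d => // s sd.
have q0 : C0 (fun z => (T s f z - f z) / rval s).
  rewrite (_ : (fun z => _) = fun z => (rval s)^-1 * (T s f z - f z)).
    by apply: C0_scale; apply: C0_sub => //; exact: T_C0.
  by apply/funext => z; rewrite mulrC.
have := @semigroup_dist t _ _ _ q0 g0 (hd s sd).
suff -> : T t (fun z => (T s f z - f z) / rval s) =
  fun z => (T s (T t f) z - T t f z) / rval s by [].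
rewrite (_ : (fun z => (T s f z - f z) / rval s) =
    fun z => (rval s)^-1 * T s f z + ((- (rval s)^-1) * f z + 0)).
  rewrite T_lin; [|exact: T_C0|exact: C0_lin f0 C0_0].
  rewrite T_lin//; last exact: C0_0.
  have -> : T t (fun=> 0) = fun=> 0.
    apply/funext => z; apply/eqP; rewrite -normr_le0.
    by apply: T_le => [|y]; [exact: C0_0|rewrite normr0].
  by apply/funext => z; rewrite -!TD// addRplusC; ring.
by apply/funext => z; ring.
Qed.

Lemma generator0 : generator T (fun=> 0) (fun=> 0).
Proof.
split; [exact: C0_0|exact: C0_0|].
move=> e e0; apply/near_dRplus0P; exists 1 => // t _ z.
have -> : T t (fun=> 0) = fun=> 0.
  apply/funext => y; apply/eqP; rewrite -normr_le0.
  by apply: T_le => [|w]; [exact: C0_0|rewrite normr0].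
by rewrite subrr mul0r subrr normr0 ltW.
Qed.

(** For fixed t, [generator_increment] is applied to an approximating pair; its bound involves only
    the variation of T_s g over s <= t, which is small uniformly in the approximation. *)
Lemma generator_closed (D : set (E R -> R)) f g :
  closure_on (generator T) D f g -> generator T f g.
Proof.
move=> cl; have f0 : C0 f.
  by apply: C0_closed => e /cl[f' [g' [_ [f'0 _ _] ? _]]]; exists f'.
have g0 : C0 g.
  by apply: C0_closed => e /cl[f' [g' [_ [_ g'0 _] _ ?]]]; exists g'.
split=> // e e0; have [d d0 hd] := T_cont g0 (divr_gt0 e0 (ltr0Sn R 3)).
apply/near_dRplus0P; exists d => // t /andP[t0 td] z.
(* Replacing f by f' in the quotient costs 2 eta / t <= e/4, which is why eta depends on t; the
   bound e/12 controls the three errors between g and g'. The total is at most 3e/4. *)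
pose eta := Num.min (e / 12) (rval t * (e / 8)).
have eta0 : 0 < eta by rewrite lt_min !divr_gt0//= mulr_gt0// divr_gt0.
have [f' [g' [_ gen ff' gg']]] := cl eta eta0; have [f'0 g'0 _] := gen.
have inc : forall s, rval s <= rval t -> sup_dist_le (T s g') g' (eta + e / 4 + eta).
  move=> s st; apply: (sup_dist_le_trans _ gg').
  apply: (@sup_dist_le_trans _ _ (T s g)); last by apply: hd; exact: le_lt_trans st td.
  by apply: semigroup_dist => //; exact: sup_dist_le_sym gg'.
have h1 := generator_increment gen inc z.
have h2 := semigroup_dist t f0 f'0 ff' z; have h3 := ff' z; have h4 := gg' z.
have e1 : eta <= e / 12 by rewrite ge_min lexx.
have e2 : eta <= rval t * (e / 8) by rewrite ge_min lexx orbT.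
rewrite -(ler_pM2l t0) -{1}(gtr0_norm t0) -normrM mulrBr.
rewrite [rval t * (_ / _)]mulrC divfK ?gt_eqF//.
have h4' : `|rval t * g z - rval t * g' z| <= rval t * (e / 12).
  by rewrite -mulrBr normrM gtr0_norm// ler_pM2l// (le_trans h4).
have h5 : rval t * eta <= rval t * (e / 12) by rewrite ler_pM2l.
move: h1 h2 h3 h4'; rewrite !ler_norml => /andP[? ?] /andP[? ?] /andP[? ?] /andP[? ?].
have te : 0 < rval t * e by rewrite mulr_gt0.
by apply/andP; split; lra.
Qed.

(** From (1 + h) f = h (f - g) + T_h f - (T_h f - f - h g) and contractivity, (1 + h) sup |f| <= h
    (e + eta) + sup |f|; the supremum need not be attained. *)
Lemma generator_dissipative f g (e : R) : generator T f g ->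
  sup_dist_le f g e -> forall z, `|f z| <= e.
Proof.
move=> [f0 g0 gen] fg; pose S := [set `|f z| | z in [set: E R]].
have [M Mf] := C0_bounded f0.
have Sub : has_ubound S by exists M => _ [z _ <-].
have fS z : `|f z| <= sup S by apply: ub_le_sup => //; exists z.
suff : sup S <= e by move=> Se z; exact: le_trans (fS z) Se.
apply/ler_addgt0Pr => eta eta0.
have /near_dRplus0P[d d0 hd] := gen eta eta0.
pose h := to_Rplus (d / 2); have rh : rval h = d / 2 by rewrite to_RplusK// divr_ge0// ltW.
have h0 : 0 < rval h by rewrite rh divr_gt0.
have hd' : rval h < d by rewrite rh; lra.
have h1 : 0 < 1 + rval h by rewrite addr_gt0.
suff : sup S <= (rval h * (e + eta) + sup S) / (1 + rval h).
  rewrite ler_pdivlMr// mulrDr mulr1 [leLHS]addrC lerD2r [_ * (e + _)]mulrC.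
  by rewrite ler_pM2r.
apply: ge_sup; first by exists `|f (Rplus0 R, 0%N)|; exists (Rplus0 R, 0%N).
move=> _ [z _ <-]; rewrite ler_pdivlMr//.
have := hd h; rewrite h0 hd' => /(_ isT z) /= h2.
have h3 := T_le h f0 fS z; have h4 := fg z.
have h2' : `|T h f z - f z - rval h * g z| <= rval h * eta.
  move: h2; rewrite -(ler_pM2l h0) -{1}(gtr0_norm h0) -normrM mulrBr.
  by rewrite [rval h * (_ / _)]mulrC divfK ?gt_eqF.
have h4' : `|rval h * f z - rval h * g z| <= rval h * e.
  by rewrite -mulrBr normrM gtr0_norm// ler_pM2l.
rewrite -[1 + rval h]gtr0_norm// -normrM.
move: h2' h3 h4'; rewrite !ler_norml => /andP[? ?] /andP[? ?] /andP[? ?].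
by apply/andP; split; lra.
Qed.

(** * A dense invariant subspace of the domain is a core *)

Section core.
Variable D : set (E R -> R).
Hypothesis D0 : D (fun=> 0).
Hypothesis D_lin : forall (a : R) f g, D f -> D g -> D (fun z => a * f z + g z).
Hypothesis D_T : forall t f, D f -> D (T t f).
Hypothesis D_gen : forall f, D f -> exists g, generator T f g.
Hypothesis D_dense : forall f (e : R), C0 f -> 0 < e ->
  exists2 g, D g & sup_dist_le f g e.

(* The approximate solution of f - A f = h is the truncated resolvent
   s sum_(i < N) (1 + s)^-(i+1) T_(i s) h of the difference quotient
   (T_s - 1) / s. *)
Lemma resolvent_range_dense h (e : R) : D h -> 0 < e ->
  exists f g, [/\ D f, generator T f g & sup_dist_le (fun z => f z - g z) h e].
Proof.
move=> Dh e0; have [k hk] := D_gen Dh; have [h0 k0 gen] := hk.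
have e20 : 0 < e / 2 by rewrite divr_gt0.
have /near_dRplus0P[d d0 hd] := gen (e / 2) e20.
pose s := to_Rplus (d / 2); have rs : rval s = d / 2 by rewrite to_RplusK// divr_ge0// ltW.
have s0 : 0 < rval s by rewrite rs divr_gt0.
have sd : rval s < d by rewrite rs; lra.
have step y : `|T s h y - (rval s * k y + h y)| <= rval s * (e / 2).
  have := hd s; rewrite s0 sd => /(_ isT y).
  rewrite -(ler_pM2l s0) -{1}(gtr0_norm s0) -normrM mulrBr [rval s * (_ / _)]mulrC divfK ?gt_eqF//.
  by rewrite opprD addrA addrAC.
pose rho := (1 + rval s)^-1.
have s1 : 0 < 1 + rval s by rewrite addr_gt0.
have rho0 : 0 < rho by rewrite invr_gt0.
(* With (T_s h - h) / s in place of k = A h the sum telescopes to h - rho^N T_(Ns) h. The i-th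
   replacement costs s rho^(i+1) e/2, and since s rho = 1 - rho these weights sum to 1 - rho^N. *)
have claim N : exists f g, [/\ D f, generator T f g & forall z,
    `|f z - g z - (h z - rho ^+ N * T (Rplus_natmul s N) h z)| <= (1 - rho ^+ N) * (e / 2)].
  elim: N => [|N [f [g [Df fg hN]]]].
    exists (fun=> 0), (fun=> 0); split=> //; first exact: generator0.
    by move=> z; rewrite /= T0// expr0 mul1r !subrr mul0r normr0.
  exists (fun z => (rval s * rho ^+ N.+1) * T (Rplus_natmul s N) h z + f z).
  exists (fun z => (rval s * rho ^+ N.+1) * T (Rplus_natmul s N) k z + g z).
  split; first by apply: D_lin => //; exact: D_T.
    by apply: generator_lin => //; exact: generator_semigroup.
  move=> z; have h1 := hN z.
  have h2 := @semigroup_dist (Rplus_natmul s N) _ _ _ (T_C0 s h0) (C0_lin (rval s) k0 h0) step z.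
  rewrite T_lin// in h2; rewrite [Rplus_natmul s N.+1]/= TD//.
  move: h1 h2; set a := T _ (T _ _) z; set b := T _ k z; set c := T _ h z => h1 h2.
  have rr : rho ^+ N = rho ^+ N.+1 + rho ^+ N.+1 * rval s.
    by rewrite exprSr -{1}[rho ^+ N]mulr1 -{1}(mulVf (lt0r_neq0 s1)) -/rho; ring.
  have r0 : 0 <= rho ^+ N.+1 by rewrite exprn_ge0// ltW.
  have h2' : `|rho ^+ N.+1 * a - rho ^+ N.+1 * (rval s * b + c)| <= rho ^+ N.+1 * (rval s * (e / 2)).
    by rewrite -mulrBr normrM ger0_norm// ler_wpM2l.
  move: h1 h2'; rewrite rr; move: (rho ^+ N.+1) => p.
  rewrite !ler_norml => /andP[? ?] /andP[? ?]; apply/andP; split; lra.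
have [M Mh] := C0_bounded h0.
have M0 : 0 <= M by apply: le_trans (normr_ge0 _) (Mh (Rplus0 R, 0%N)).
have [N hN] : exists N, rho ^+ N * M <= e / 2.
  have rho1 : `|rho| < 1 by rewrite gtr0_norm// invf_lt1// ltrDl.
  have : rho ^+ n * M @[n --> \oo] --> (0 * M : R).
    by apply: cvgM; [exact: cvg_expr|exact: cvg_cst].
  rewrite mul0r => /cvgrPdist_lt/(_ _ e20)[N _ /(_ N (leqnn _))].
  by rewrite /= sub0r normrN => /(le_lt_trans (ler_norm _))/ltW; exists N.
have [f [g [Df fg hfg]]] := claim N; exists f, g; split=> // z.
have := hfg z; have := T_le (Rplus_natmul s N) h0 Mh z.
set c := T _ h z => h1 h2.
have r0 : 0 <= rho ^+ N by rewrite exprn_ge0// ltW.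
have h1' : `|rho ^+ N * c| <= e / 2.
  by rewrite normrM ger0_norm// (le_trans _ hN)// ler_wpM2l.
have re : 0 <= rho ^+ N * (e / 2) by rewrite mulr_ge0// ltW.
move: h1' h2; rewrite !ler_norml => /andP[? ?] /andP[? ?].
by apply/andP; split; lra.
Qed.

(** Given (f, g) in the graph, f - g is approximated in D and then by some f' - g' with f' in D.
    Dissipativity applied to the difference gives f' close to f, and hence g' close to g. *)
Lemma is_core_dense : is_core (generator T) D.
Proof.
split=> // f g; split; last exact: generator_closed.
move=> gen e e0; have [f0 g0 _] := gen.
have e40 : 0 < e / 4 by rewrite divr_gt0.
have [h Dh fgh] := D_dense (C0_sub f0 g0) e40.
have [f' [g' [Df' gen' h']]] := resolvent_range_dense Dh e40.
have fgfg z : `|(f z - g z) - (f' z - g' z)| <= e / 4 + e / 4.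
  exact: sup_dist_le_trans fgh (sup_dist_le_sym h') z.
have ff' z : `|f z - f' z| <= e / 2.
  have -> : f z - f' z = -1 * f' z + f z by ring.
  move: z; apply: (@generator_dissipative _ (fun z => -1 * g' z + g z)).
    exact: generator_lin.
  by move=> z; have := fgfg z; rewrite !ler_norml => /andP[? ?]; apply/andP; split; lra.
exists f', g'; split=> // z; first by apply: le_trans (ff' z) _; lra.
have := ff' z; have := fgfg z; rewrite !ler_norml => /andP[? ?] /andP[? ?].
by apply/andP; split; lra.
Qed.

End core.
End semigroups.

(** * Differentiating the exponentials along the flow *)

Section fqr_calculus.
Context {R : realType}.
Implicit Types (q r b c y : R) (z : E R).

(** The remainder is nonnegative and at most [b * (1 - expR (- b))], by [expR (- b) * (1 + b) <= 1];
    the exponential factor serves negative b. *)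
Lemma expR_taylor1 b : `|expR (- b) - 1 + b| <= b ^+ 2 * expR `|b|.
Proof.
have lo (y : R) : 0 <= expR y - 1 - y by have := expR_ge1Dx y; lra.
have -> : expR (- b) - 1 + b = expR (- b) - 1 - (- b) by ring.
rewrite ger0_norm//; have e1 : 1 <= expR `|b| by rewrite -expR0 ler_expR.
have h : expR (- b) * (1 + b) <= 1.
  apply: (@le_trans _ _ (expR (- b) * expR b)).
    by rewrite ler_wpM2l ?expR_ge0 ?expR_ge1Dx.
  by rewrite -expRD addNr expR0.
have [b0|b0] := leP 0 b.
  rewrite ger0_norm// in e1 *.
  have h1 := lo (- b); have h2 := lo b.
  have : b ^+ 2 <= b ^+ 2 * expR b by rewrite ler_peMr ?sqr_ge0.
  have : b * (1 - expR (- b)) <= b * b by rewrite ler_wpM2l//; lra.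
  rewrite expr2; lra.
rewrite ltr0_norm// in e1 *.
have : - b * (expR (- b) - 1) <= - b * (- b * expR (- b)).
  by rewrite ler_wpM2l//; lra.
rewrite expr2; lra.
Qed.

Lemma mulr_expRN_le1 y : 0 <= y -> y * expR (- y) <= 1.
Proof.
move=> y0; rewrite expRN ler_pdivrMr ?expR_gt0// mul1r.
by have := expR_ge1Dx y; lra.
Qed.

(** Four times the square of (y/2) e^{-y/2} <= 1. *)
Lemma sqr_expRN_le4 y : 0 <= y -> y ^+ 2 * expR (- y) <= 4.
Proof.
move=> y0; have := mulr_expRN_le1 (divr_ge0 y0 (ler0n R 2)).
set p := (X in X <= 1) => p1.
have p0 : 0 <= p by rewrite mulr_ge0 ?expR_ge0// divr_ge0.
have -> : y ^+ 2 * expR (- y) = 4 * (p * p).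
  rewrite /p {1}(_ : - y = - (y / 2) + - (y / 2)); last by lra.
  by rewrite expRD; field.
by have := mulr_ile1 p0 p0 p1 p1; lra.
Qed.

(** In 1 - 1/y <= ln y <= y - 1 the two bounds differ by (y - 1)^2 / y. *)
Lemma ln_linear y : 1 / 2 <= y -> `|ln y - (y - 1)| <= 2 * (y - 1) ^+ 2.
Proof.
move=> y2; have y0 : 0 < y by lra.
have up : ln y <= y - 1.
  have := @le_ln1Dx R (y - 1); rewrite (addrC 1) subrK => h.
  by apply: h; lra.
have lo : 1 - y^-1 <= ln y.
  have : ln y^-1 <= y^-1 - 1.
    have yi : 0 < y^-1 by rewrite invr_gt0.
    have := @le_ln1Dx R (y^-1 - 1); rewrite (addrC 1) subrK => h.
    by apply: h; lra.
  by rewrite lnV ?posrE//; lra.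
have : (y - 1) ^+ 2 * y^-1 <= (y - 1) ^+ 2 * 2.
  by rewrite ler_wpM2l ?sqr_ge0// -[2 in leRHS]invrK lef_pV2 ?posrE//; lra.
have -> : (y - 1) ^+ 2 * y^-1 = (y - 1) - (1 - y^-1) by field; rewrite gt_eqF.
by move=> h; rewrite ler_norml; apply/andP; split; lra.
Qed.

Lemma fqr_expR q r z : 0 < r ->
  fqr q r z = expR (- (rval z.1 * q + z.2%:R * - ln r)).
Proof.
move=> r0; rewrite /fqr opprD mulrN opprK expRD mulrC mulrC [q * _]mulrC.
by congr (_ * _); rewrite expRM_natl lnK.
Qed.

(** The rate at which [fqr q r] decays exponentially along [Enorm]. *)
Definition fqr_rate q r : R := Num.min q (- ln r).

Lemma fqr_rate_gt0 q r : 0 < q -> 0 < r < 1 -> 0 < fqr_rate q r.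
Proof. by move=> q0 /andP[r0 r1]; rewrite lt_min q0 oppr_gt0 ln_lt0// r0. Qed.

Lemma fqr_rate_le q r z :
  fqr_rate q r * Enorm z <= rval z.1 * q + z.2%:R * - ln r.
Proof.
rewrite /Enorm mulrDr lerD// mulrC ler_wpM2l ?rval_ge0// ge_min lexx//.
by rewrite orbT.
Qed.

Lemma fqr_decay q r z : 0 < r ->
  0 <= fqr q r z <= expR (- (fqr_rate q r * Enorm z)).
Proof.
move=> r0; rewrite fqr_expR// expR_ge0 ler_expR lerN2; exact: fqr_rate_le.
Qed.

(** The affine factor is the shape that the generator produces on [fqr q r]; exponential decay
    absorbs it. *)
Lemma fqr_C0 q r (a b e : R) : 0 < q -> 0 < r < 1 ->
  C0 (fun z => (a * rval z.1 + b * z.2%:R + e) * fqr q r z).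
Proof.
move=> q0 r01; have r0 : 0 < r by case/andP: r01.
have c0 := fqr_rate_gt0 q0 r01; set c := fqr_rate q r in c0.
apply/C0P; split=> [n x|eps eps0].
  apply: (@continuous_comp _ _ _ (@rval R)
    (fun x : R => (a * x + b * n%:R + e) * (expR (- (q * x)) * r ^+ n))).
    exact: rval_continuous.
  apply: cvgM; last apply: cvgM; last exact: cvg_cst.
    apply: cvgD; last exact: cvg_cst.
    apply: cvgD; last exact: cvg_cst.
    by apply: cvgM; [exact: cvg_cst|exact: cvg_id].
  apply: (@continuous_comp _ _ _ (fun x : R => - (q * x)) expR); last exact: continuous_expR.
  by apply: cvgN; apply: cvgM; [exact: cvg_cst|exact: cvg_id].
pose K := `|a| + `|b| + `|e|; have K0 : 0 <= K by rewrite !addr_ge0.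
(* [Enorm z > 1] absorbs the constant term into K [Enorm z]; then y^2 e^{-y} <= 4 at y = c [Enorm z]
   bounds the product by 4 K / c^2 / [Enorm z]. *)
exists (Num.max 1 (4 * K / c ^+ 2 / eps)) => z; rewrite gt_max => /andP[z1 zM].
have z0 : 0 < Enorm z by apply: lt_trans z1.
have [f0 fe] := andP (fqr_decay q z r0); rewrite -/c in fe.
rewrite normrM (ger0_norm f0).
have h1 : `|a * rval z.1 + b * z.2%:R + e| <= K * Enorm z.
  rewrite (le_trans (ler_normD _ _))// (le_trans (lerD (ler_normD _ _) (lexx _)))//.
  rewrite /K !mulrDl !normrM (ger0_norm (rval_ge0 _)) normr_nat.
  rewrite lerD// ?lerD// ?ler_wpM2l//.
  - by rewrite lerDl.
  - by rewrite lerDr rval_ge0.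
  - by rewrite ler_peMr// ltW.
apply: (@le_lt_trans _ _ (K * Enorm z * expR (- (c * Enorm z)))).
  by rewrite ler_pM// mulr_ge0// ltW.
have h2 := sqr_expRN_le4 (mulr_ge0 (ltW c0) (ltW z0)).
have h3 : K * Enorm z * expR (- (c * Enorm z)) <= 4 * K / c ^+ 2 / Enorm z.
  rewrite ler_pdivlMr// ler_pdivlMr ?exprn_gt0//.
  rewrite [leRHS]mulrC [leLHS](_ : _ = K * ((c * Enorm z) ^+ 2 * expR (- (c * Enorm z)))); last by ring.
  by rewrite ler_wpM2l.
apply: (le_lt_trans h3); rewrite ltr_pdivrMr//.
by rewrite [ltRHS]mulrC -ltr_pdivrMr.
Qed.

Lemma fqr_in_C0 q r : 0 < q -> 0 < r < 1 -> C0 (fqr q r).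
Proof.
move=> q0 r01; have := @fqr_C0 q r 0 0 1 q0 r01.
congr C0; apply/funext => z; by rewrite !mul0r !add0r mul1r.
Qed.

Lemma has_derivative0 (g : Rplus R -> R) (l e : R) :
  has_derivative g (Rplus0 R) l -> 0 < e ->
  exists2 d : R, 0 < d & forall t, 0 < rval t < d ->
    `|(g t - g (Rplus0 R)) / rval t - l| < e.
Proof.
move=> gl e0; have /near_dRplus0P[d d0 dP] := gl _ (nbhsx_ballx l e e0).
exists d => // t /dP; rewrite /ball /= /diff_quotient rval0 subr0 distrC.
exact.
Qed.

Lemma ln_difference_quotient (v : Rplus R -> R) (l : R) :
  (forall t, 0 < v t) -> has_derivative v (Rplus0 R) l ->
  forall e : R, 0 < e -> exists2 d : R, 0 < d & forall t, 0 < rval t < d ->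
    `|(ln (v t) - ln (v (Rplus0 R))) / rval t - l / v (Rplus0 R)| <= e.
Proof.
move=> v0 dv e e0; set r := v (Rplus0 R); have r0 : 0 < r by exact: v0.
have [d1 d10 h1] := has_derivative0 dv ltr01.
have [d2 d20 h2] := has_derivative0 dv (divr_gt0 (mulr_gt0 e0 r0) (ltr0Sn R 1)).
pose K := `|l| + 1; have K0 : 0 < K by rewrite ltr_wpDl.
(* With v t = r y and |y - 1| <= t K / r, [d3] keeps y >= 1/2 so that [ln_linear] applies, and [d4]
   brings its remainder 2 (t K / r)^2 below t e/2. *)
pose d3 := r / 2 / K; have d30 : 0 < d3 by rewrite !divr_gt0.
pose d4 := e / 4 / (K / r) ^+ 2.
have d40 : 0 < d4 by rewrite !divr_gt0// exprn_gt0// divr_gt0.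
exists (Num.min (Num.min d1 d2) (Num.min d3 d4)).
  by rewrite !lt_min d10 d20 d30.
move=> t; rewrite !lt_min => /andP[t0 /andP[/andP[t1 t2] /andP[t3 t4]]].
have B1 := h1 t; rewrite t0 t1 in B1; have {}B1 := B1 isT.
have B2 := h2 t; rewrite t0 t2 in B2; have {}B2 := B2 isT.
move: B1 B2; rewrite -/r; set B := (v t - r) / rval t => B1 B2.
have BK : `|B| <= K.
  by have := ler_normD (B - l) l; rewrite subrK /K; lra.
have vt : v t = r * (1 + rval t * B / r).
  by rewrite /B; field; rewrite !gt_eqF.
set y := 1 + rval t * B / r in vt.
have y1 : `|y - 1| <= rval t * (K / r).
  have -> : y - 1 = rval t * (B * r^-1) by rewrite /y; ring.
  rewrite normrM (gtr0_norm t0) ler_pM2l// normrM normfV (gtr0_norm r0).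
  by rewrite ler_pM2r ?invr_gt0.
have y2 : 1 / 2 <= y.
  have : rval t * (K / r) <= 1 / 2.
    have -> : 1 / 2 = d3 * (K / r) by rewrite /d3; field; rewrite !gt_eqF.
    by rewrite ler_pM2r ?divr_gt0// ltW.
  by move: y1; rewrite ler_norml => /andP[? _]; lra.
have y0 : 0 < y by lra.
rewrite vt lnM ?posrE// [ln r + _]addrC addrK.
have h := ln_linear y2.
have h' : `|ln y - (y - 1)| <= rval t * (e / 2).
  apply: (le_trans h); apply: (@le_trans _ _ (2 * (rval t * (K / r)) ^+ 2)).
    rewrite ler_pM2l// -[leLHS]real_normK ?num_real// lerXn2r// nnegrE//.
    by rewrite mulr_ge0 ?rval_ge0 ?divr_ge0 ?(ltW K0) ?(ltW r0).
  have : rval t * (K / r) ^+ 2 <= e / 4.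
    by rewrite -ler_pdivlMr ?exprn_gt0 ?divr_gt0// ltW.
  by rewrite -(ler_pM2l t0) exprMn; lra.
have -> : ln y / rval t - l / r = (ln y - (y - 1)) / rval t + (B - l) / r.
  by rewrite /y; field; rewrite !gt_eqF.
rewrite (le_trans (ler_normD _ _))// [leRHS]splitr lerD//.
  by rewrite normrM normfV (gtr0_norm t0) ler_pdivrMr// mulrC.
rewrite normrM normfV (gtr0_norm r0) ler_pdivrMr// ltW//.
by rewrite mulrAC.
Qed.

(* With v = exp(-w), the exponent of f_{u,v} moves by b = x (u - q) + n (w - w0),
   and exp(-b) is expanded to first order; the decay of f_{q,r} absorbs the
   powers of x + n. *)
Lemma fqr_flow_derivative (u v : Rplus R -> R) (A B : R) :
  (forall t, 0 < u t /\ 0 < v t < 1) ->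
  has_derivative u (Rplus0 R) (- A) -> has_derivative v (Rplus0 R) B ->
  let q := u (Rplus0 R) in let r := v (Rplus0 R) in
  forall e : R, 0 < e -> exists2 d : R, 0 < d & forall t, 0 < rval t < d ->
    forall z, `|(fqr (u t) (v t) z - fqr q r z) / rval t
      - (A * rval z.1 + B / r * z.2%:R) * fqr q r z| <= e.
Proof.
move=> uv du dv q r e e0.
have [q0 r01] := uv (Rplus0 R); rewrite -/q -/r in q0 r01.
have r0 : 0 < r by case/andP: r01.
have c0 := fqr_rate_gt0 q0 r01; set c := fqr_rate q r in c0.
have v0 t : 0 < v t by have [_ /andP[]] := uv t.
(* The error of the linear term is at most s eta e^{-cs} with s = [Enorm z], and c s e^{-cs} <= 1
   turns it into e/2. *)
pose eta := e * c / 2; have eta0 : 0 < eta by rewrite !divr_gt0// mulr_gt0.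
pose K := `|A| + `|B / r| + eta.
have K0 : 0 < K by rewrite ltr_wpDl// addr_ge0.
have [d1 d10 h1] := has_derivative0 du eta0.
have [d2 d20 h2] := ln_difference_quotient v0 dv eta0.
(* [d3] gives |b| <= (c/2) s, so the Taylor factor e^{|b|} uses up half of the decay e^{-cs}. The
   remaining half yields (s c/2)^2 e^{-sc/2} <= 4, whence the constant 16 / c^2 in [d4]. *)
pose d3 := c / 2 / K; have d30 : 0 < d3 by rewrite !divr_gt0.
pose d4 := e / 2 / (K ^+ 2 * (16 / c ^+ 2)).
have d40 : 0 < d4.
  by rewrite !divr_gt0// mulr_gt0 ?exprn_gt0// divr_gt0// exprn_gt0.
exists (Num.min (Num.min d1 d2) (Num.min d3 d4)).
  by rewrite !lt_min d10 d20 d30.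
move=> t; rewrite !lt_min => /andP[t0 /andP[/andP[t1 t2] /andP[t3 t4]]] z.
have A1 := h1 t; rewrite t0 t1 in A1; have {}A1 := ltW (A1 isT).
have W1 := h2 t; rewrite t0 t2 in W1; have {}W1 := W1 isT.
move: A1 W1; rewrite -/q -/r.
set At := (u t - q) / rval t; set Wt := (ln (v t) - ln r) / rval t => A1 W1.
set s := Enorm z; have s0 : 0 <= s by exact: Enorm_ge0.
set x := rval z.1; set n : R := z.2%:R.
have x0 : 0 <= x by exact: rval_ge0.
have n0 : 0 <= n by exact: ler0n.
pose b := rval t * (x * At - n * Wt).
have -> : fqr (u t) (v t) z = fqr q r z * expR (- b).
  rewrite !fqr_expR// -expRD; congr expR; rewrite -/x -/n /b /At /Wt.
  by field; rewrite gt_eqF.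
have [f0 fe] := andP (fqr_decay q z r0); rewrite -/c -/s in fe.
set F := fqr q r z in f0 fe *.
have AK : `|At| <= K.
  have := ler_normD (At - - A) (- A); rewrite subrK normrN /K.
  by have := normr_ge0 (B / r); lra.
have WK : `|Wt| <= K.
  have := ler_normD (Wt - B / r) (B / r); rewrite subrK /K.
  by have := normr_ge0 A; lra.
have bK : `|b| <= rval t * K * s.
  rewrite /b normrM (gtr0_norm t0) -mulrA ler_pM2l//.
  rewrite (le_trans (ler_normB _ _))// (normrM x) (normrM n) (ger0_norm x0) (ger0_norm n0).
  by rewrite /s /Enorm mulrDr lerD// mulrC ler_wpM2r.
have tK : rval t * K <= c / 2.
  have -> : c / 2 = d3 * K by rewrite /d3 divfK ?gt_eqF.
  by rewrite ler_pM2r// ltW.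
have bc : `|b| <= c / 2 * s by apply: le_trans bK _; rewrite ler_wpM2r.
have T1 : `|F * (expR (- b) - 1 + b)| <= rval t * (e / 2).
  rewrite normrM (ger0_norm f0).
  apply: (@le_trans _ _ (expR (- (c * s)) * ((rval t * K * s) ^+ 2 * expR (c / 2 * s)))).
    apply: ler_pM => //; apply: (le_trans (expR_taylor1 b)).
    apply: ler_pM; rewrite ?sqr_ge0 ?expR_ge0 ?ler_expR//.
    rewrite -[leLHS]real_normK ?num_real// lerXn2r// nnegrE//.
    by rewrite !mulr_ge0 ?(ltW t0) ?(ltW K0).
  have -> : expR (- (c * s)) * ((rval t * K * s) ^+ 2 * expR (c / 2 * s)) =
     rval t * (rval t * K ^+ 2 * (4 / c ^+ 2)) * ((c / 2 * s) ^+ 2 * expR (- (c / 2 * s))).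
    rewrite (_ : - (c * s) = - (c / 2 * s) + - (c / 2 * s)); last by field.
    rewrite expRD [expR (- _) * expR _ * _]mulrC !mulrA -[_ * expR (c / 2 * s) * _]mulrA -expRD subrr expR0 mulr1.
    by field; rewrite gt_eqF.
  have h4 : rval t * (K ^+ 2 * (16 / c ^+ 2)) <= e / 2.
    rewrite -ler_pdivlMr ?(ltW t4)// mulr_gt0 ?exprn_gt0// divr_gt0// exprn_gt0//.
  have h5 := sqr_expRN_le4 (mulr_ge0 (divr_ge0 (ltW c0) (ler0n R 2)) s0).
  apply: (@le_trans _ _ (rval t * (rval t * K ^+ 2 * (4 / c ^+ 2)) * 4)).
    apply: ler_wpM2l h5; have ? := ltW t0; have ? := sqr_ge0 K; have ? : 0 <= 4 / c ^+ 2 by rewrite divr_ge0 ?sqr_ge0.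
    by apply: mulr_ge0 => //; apply: mulr_ge0 => //; exact: mulr_ge0.
  rewrite -mulrA ler_pM2l// [leLHS](_ : _ = rval t * (K ^+ 2 * (16 / c ^+ 2)))//.
  by field; rewrite gt_eqF.
have T2 : `|F * ((A * x + B / r * n) - (n * Wt - x * At))| <= e / 2.
  rewrite normrM (ger0_norm f0).
  have l : `|(A * x + B / r * n) - (n * Wt - x * At)| <= s * eta.
    have -> : (A * x + B / r * n) - (n * Wt - x * At) =
      x * (At - - A) - n * (Wt - B / r) by ring.
    rewrite (le_trans (ler_normB _ _))// (normrM x) (normrM n) (ger0_norm x0) (ger0_norm n0).
    by rewrite /s /Enorm mulrDl lerD// ler_wpM2l.
  apply: (@le_trans _ _ (expR (- (c * s)) * (s * eta))); first exact: ler_pM.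
  have -> : expR (- (c * s)) * (s * eta) = (e / 2) * (c * s * expR (- (c * s))).
    by rewrite /eta; ring.
  rewrite ler_piMr ?divr_ge0 ?(ltW e0)//.
  by apply: mulr_expRN_le1; rewrite mulr_ge0// ltW.
have -> : (F * expR (- b) - F) / rval t - (A * x + B / r * n) * F =
  (F * (expR (- b) - 1 + b)) / rval t - F * ((A * x + B / r * n) - (n * Wt - x * At)).
  move: (expR (- b)) => Y; rewrite /b; move: At Wt {A1 W1 b AK WK bK bc T1 T2} => a w.
  by field; rewrite !gt_eqF.
rewrite (le_trans (ler_normB _ _))// [leRHS]splitr lerD//.
by rewrite normrM normfV (gtr0_norm t0) ler_pdivrMr// [leRHS]mulrC.
Qed.

End fqr_calculus.

(** * The operator on the exponentials *)

Section half_line_derivative.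
Context {R : realType}.
Implicit Types (g h : Rplus R -> R) (x y : Rplus R).

Lemma has_derivativeP g x (l : R) : has_derivative g x l <->
  forall e : R, 0 < e -> exists2 d : R, 0 < d & forall y,
    0 < `|rval y - rval x| < d -> `|diff_quotient g x y - l| < e.
Proof.
split=> [gl e e0|gl A /nbhs_ballP[e /= e0 eA]].
  have /near_RplusP[d d0 dP] := gl _ (nbhsx_ballx l e e0).
  exists d => // y /andP[yx yd]; have := dP y yd; rewrite /ball /= distrC.
  apply; apply: contraTneq yx => ->; by rewrite subrr normr0 ltxx.
have [d d0 dP] := gl e e0.
apply/near_RplusP; exists d => // y yd /= yx.
apply: eA; rewrite /ball /= distrC; apply: dP.
by rewrite yd andbT normr_gt0 subr_eq0; apply: contra yx => /eqP/rval_inj ->.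
Qed.

(** No point of the half-line is isolated: points slightly to the right of x are always available,
    also at x = 0. *)
Lemma has_derivative_unique g x (l m : R) :
  has_derivative g x l -> has_derivative g x m -> l = m.
Proof.
move=> /has_derivativeP gl /has_derivativeP gm; apply/eqP; rewrite -subr_eq0.
apply/negPn/negP => lm; have e0 : 0 < `|l - m| / 2 by rewrite divr_gt0// normr_gt0.
have [d d0 dl] := gl _ e0; have [d' d'0 dm] := gm _ e0.
have dd : 0 < Num.min d d' / 2 by rewrite divr_gt0// lt_min d0.
pose y := to_Rplus (rval x + Num.min d d' / 2).
have yx : `|rval y - rval x| = Num.min d d' / 2.
  by rewrite to_RplusK ?addr_ge0 ?rval_ge0 ?ltW// addrC addKr gtr0_norm.
have md : Num.min d d' / 2 < Num.min d d'.
  by rewrite ltr_pdivrMr// ltr_pMr ?ltr1n// lt_min d0.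
have := dl y; rewrite yx dd (lt_le_trans md) ?ge_min ?lexx// => /(_ isT) h1.
have := dm y; rewrite yx dd (lt_le_trans md) ?ge_min ?lexx ?orbT// => /(_ isT) h2.
have := ler_distD (diff_quotient g x y) l m.
rewrite (distrC l (diff_quotient g x y)) => h; lra.
Qed.

Lemma derivativeE g x (l : R) : has_derivative g x l -> derivative g x = l.
Proof.
move=> gl; rewrite /derivative /lim /lim_in.
apply: (@has_derivative_unique g x) => //.
exact: (@getPex _ _ (ex_intro _ l gl)).
Qed.

Lemma has_derivative_lin g h x (a l m : R) :
  has_derivative g x l -> has_derivative h x m ->
  has_derivative (fun y => a * g y + h y) x (a * l + m).
Proof.
move=> /has_derivativeP gl /has_derivativeP hm; apply/has_derivativeP => e e0.
have a1 : 0 < `|a| + 1 by rewrite ltr_wpDl.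
have e20 : 0 < e / 2 by rewrite divr_gt0.
have [d d0 dl] := gl _ (divr_gt0 e20 a1); have [d' d'0 dm] := hm _ e20.
exists (Num.min d d') => [|y]; first by rewrite lt_min d0.
rewrite lt_min => /andP[y0 /andP[yd yd']].
have := dl y; rewrite y0 yd => /(_ isT) h1.
have := dm y; rewrite y0 yd' => /(_ isT) h2.
have -> : diff_quotient (fun y => a * g y + h y) x y - (a * l + m) =
    a * (diff_quotient g x y - l) + (diff_quotient h x y - m).
  by rewrite /diff_quotient; ring.
rewrite (le_lt_trans (ler_normD _ _))// [ltRHS]splitr ler_ltD// normrM.
apply: (@le_trans _ _ ((`|a| + 1) * (e / 2 / (`|a| + 1)))).
  by rewrite ler_pM ?lerDl// ltW.
by rewrite mulrCA divff ?gt_eqF// mulr1.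
Qed.

Lemma has_derivative_expR (q : R) x :
  has_derivative (fun y => expR (- (q * rval y))) x (- q * expR (- (q * rval x))).
Proof.
apply/has_derivativeP => e e0.
set F := expR (- (q * rval x)); have F0 : 0 < F by exact: expR_gt0.
pose C := F * (q ^+ 2 * expR `|q|) + 1.
have C1 : 0 < C.
  by rewrite ltr_wpDl// mulr_ge0 ?(ltW F0)// mulr_ge0 ?sqr_ge0 ?expR_ge0.
exists (Num.min 1 (e / C)) => [|y]; first by rewrite lt_min ltr01 divr_gt0.
rewrite lt_min => /andP[y0 /andP[y1 yC]].
set t := rval y - rval x in y0 y1 yC *.
have t0 : t != 0 by rewrite -normr_gt0.
have -> : diff_quotient (fun y => expR (- (q * rval y))) x y - - q * F =
    F * (expR (- (q * t)) - 1 + q * t) / t.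
  rewrite /diff_quotient -/t -/F (_ : - (q * rval y) = - (q * rval x) + - (q * t)); last by rewrite /t; ring.
  by rewrite expRD -/F; field.
rewrite 2!normrM normfV (gtr0_norm F0) ltr_pdivrMr//.
have h : `|expR (- (q * t)) - 1 + q * t| <= q ^+ 2 * expR `|q| * `|t| ^+ 2.
  apply: le_trans (expR_taylor1 _) _.
  rewrite real_normK ?num_real// exprMn [leRHS]mulrAC.
  apply: ler_wpM2l; first by rewrite mulr_ge0 ?sqr_ge0.
  by rewrite ler_expR normrM ler_piMr// ltW.
apply: (@le_lt_trans _ _ (C * `|t| * `|t|)).
  apply: (@le_trans _ _ (F * (q ^+ 2 * expR `|q| * `|t| ^+ 2))).
    by rewrite ler_pM2l.
  have -> : F * (q ^+ 2 * expR `|q| * `|t| ^+ 2) = (C - 1) * `|t| * `|t|.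
    by rewrite /C; ring.
  by rewrite !ler_wpM2r// lerBlDr lerDl.
by rewrite ltr_pM2r// mulrC -ltr_pdivlMr.
Qed.

Lemma dxE (f g : E R -> R) :
  (forall z, has_derivative (fun x => f (x, z.2)) z.1 (g z)) -> dx f = g.
Proof. by move=> fg; apply/funext => z; exact: derivativeE. Qed.

(** The result has the same shape with new coefficients, so the identity also rewrites
    [dx (dx f)]. *)
Lemma dx_fqr_sum n (c q r : 'I_n -> R) :
  dx (fun z => \sum_(i < n) c i * fqr (q i) (r i) z) =
  (fun z => \sum_(i < n) (c i * - q i) * fqr (q i) (r i) z).
Proof.
apply: dxE => z; elim: n c q r => [|n IH] c q r.
  apply/has_derivativeP => e e0; exists 1 => // y _.
  by rewrite /diff_quotient !big_ord0 !subr0 mul0r normr0.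
have h := @has_derivative_lin _ _ _ (c ord0 * r ord0 ^+ z.2) _ _
  (@has_derivative_expR (q ord0) z.1) (IH (fun i => c (lift ord0 i))
    (fun i => q (lift ord0 i)) (fun i => r (lift ord0 i))).
move: h; congr has_derivative.
  by apply/funext => x; rewrite big_ord_recl /fqr /=; ring.
by rewrite big_ord_recl /fqr /=; ring.
Qed.

End half_line_derivative.

(** * Linearity and convergence of the jump integrals *)

Section jump_integrals.
Context {R : realType}.
Implicit Types (m : {measure set (borel (E R)) -> \bar R}) (g h : R -> nat -> R).

Lemma measurable_rval1 : measurable_fun setT (fun z : borel (E R) => rval (z : E R).1).
Proof.
apply: continuous_borel_measurable => z.
apply: (@continuous_comp _ _ _ (fst : E R -> Rplus R) (@rval R)); first exact: cvg_fst.
exact: rval_continuous.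
Qed.

Lemma measurable_slice k : measurable (@slice R k).
Proof.
apply: open_borel; rewrite (_ : slice k = (snd : E R -> nat) @^-1` [set k])//.
apply: open_comp; last exact: discrete_open.
by move=> z _; exact: cvg_snd.
Qed.

(** [jump_integral] is built from total functions, [Rintegral] and [limn]; this is the condition
    under which it is linear. *)
Definition jump_summable m g : Prop :=
  (forall k, m.-integrable (slice k)
    (EFin \o (fun z : borel (E R) => g (rval (z : E R).1) k))) /\
  cvgn (series (fun k => \int[m]_(z in slice k) g (rval (z : E R).1) k)).

Lemma jump_integral_ext m g h :
  (forall y k, 0 <= y -> g y k = h y k) ->
  jump_integral m g = jump_integral m h.
Proof.
move=> gh; rewrite /jump_integral; congr (limn (series _)); apply/funext => k.
by apply: eq_Rintegral => z _; apply: gh; exact: rval_ge0.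
Qed.

Lemma jump_summable_lin m g h (a : R) : jump_summable m g -> jump_summable m h ->
  jump_summable m (fun y k => a * g y k + h y k) /\
  jump_integral m (fun y k => a * g y k + h y k) =
    a * jump_integral m g + jump_integral m h.
Proof.
move=> [ig cg] [ih ch].
have ms := measurable_slice.
have iag k : m.-integrable (slice k)
    (EFin \o (fun z : borel (E R) => a * g (rval (z : E R).1) k)).
  rewrite (_ : _ \o _ = (fun z : borel (E R) => a%:E * (EFin \o (fun z : borel (E R) => g (rval (z : E R).1) k)) z)%E)//.
  exact: (integrableZl (ms k) a (ig k)).
have sE : series (fun k => \int[m]_(z in slice k) (a * g (rval (z : E R).1) k + h (rval (z : E R).1) k)) =
    (fun n => a * series (fun k => \int[m]_(z in slice k) g (rval (z : E R).1) k) n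
      + series (fun k => \int[m]_(z in slice k) h (rval (z : E R).1) k) n).
  apply/funext => n; rewrite /series /= mulr_sumr -big_split/=.
  by apply: eq_bigr => k _; rewrite RintegralD// RintegralZl.
have c1 : a * series (fun k => \int[m]_(z in slice k) g (rval (z : E R).1) k) n
      + series (fun k => \int[m]_(z in slice k) h (rval (z : E R).1) k) n @[n --> \oo]
    --> a * jump_integral m g + jump_integral m h.
  by apply: cvgD => //; apply: cvgM => //; exact: cvg_cst.
split; last by rewrite {1}/jump_integral sE; apply/cvg_lim.
split; last by rewrite sE; apply/cvg_ex; eexists; exact: c1.
by move=> k; exact: (integrableD (ms k) (iag k) (ih k)).
Qed.

Lemma jump_integral_sum m n (c : 'I_n -> R) (G : 'I_n -> R -> nat -> R) :
  (forall i, jump_summable m (G i)) ->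
  jump_integral m (fun y k => \sum_(i < n) c i * G i y k) =
  \sum_(i < n) c i * jump_integral m (G i).
Proof.
move=> sG; suff [] : jump_summable m (fun y k => \sum_(i < n) c i * G i y k) /\
  jump_integral m (fun y k => \sum_(i < n) c i * G i y k) =
  \sum_(i < n) c i * jump_integral m (G i) by [].
elim: n c G sG => [|n IH] c G sG.
  have s0 k : \int[m]_(z in @slice R k) (fun (_ : R) (_ : nat) => 0 : R) (rval (z : E R).1) k = 0.
    by rewrite Rintegral_cst ?mul0r//; exact: measurable_slice.
  rewrite big_ord0 (_ : (fun y k => _) = (fun _ _ => 0)); last first.
    by apply/funext => y; apply/funext => k; rewrite big_ord0.
  have sE : series (fun k => \int[m]_(z in @slice R k) (fun (_ : R) (_ : nat) => 0 : R) (rval (z : E R).1) k) = fun=> 0.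
    by apply/funext => N; rewrite /series /= big1.
  rewrite /jump_summable /jump_integral sE; split; last exact: lim_cst.
  by split; [move=> k; exact: integrable0|exact: is_cvg_cst].
have [sI eI] := IH (fun i => c (lift ord0 i)) (fun i => G (lift ord0 i)) (fun i => sG _).
have := jump_summable_lin (c ord0) (sG ord0) sI.
rewrite eI [in X in _ -> X]big_ord_recl.
rewrite (_ : (fun y k => \sum_(i < n.+1) c i * G i y k) =
  (fun y k => c ord0 * G ord0 y k + \sum_(i < n) c (lift ord0 i) * G (lift ord0 i) y k))//.
by apply/funext => y; apply/funext => k; rewrite big_ord_recl.
Qed.

(** Shaped after admissibility: [phi] is the weight of pure x-jumps, while on the slices k >= 1 a
    bounded integrand is dominated by C times the summable masses. *)
Lemma jump_summable_dominated m g (phi : R -> R) (C : R) :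
  measurable_fun setT phi -> (forall y, 0 <= y -> 0 <= phi y) ->
  (\int[m]_(z in slice 0) (phi (rval (z : E R).1))%:E
     + \sum_(1 <= k <oo) m (slice k) < +oo)%E ->
  (forall k, measurable_fun setT (fun y => g y k)) ->
  (forall y, 0 <= y -> `|g y 0%N| <= C * phi y) ->
  (forall y k, 0 <= y -> (0 < k)%N -> `|g y k| <= C) ->
  jump_summable m g.
Proof.
move=> mphi phi0 fin mg g0 gk.
have ms := measurable_slice.
have mgk k D : measurable_fun D (fun z : borel (E R) => g (rval (z : E R).1) k).
  apply: measurable_funS measurableT _ _ => //.
  exact: measurableT_comp (mg k) measurable_rval1.
have i0 : (0 <= \int[m]_(z in @slice R 0) (phi (rval (z : E R).1))%:E)%E.
  by apply: integral_ge0 => z _; rewrite lee_fin phi0// rval_ge0.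
have s0 : (0 <= \sum_(1 <= k <oo) m (slice k))%E.
  by apply: nneseries_ge0 => k _ _; exact: measure_ge0.
have ifin : (\int[m]_(z in @slice R 0) (phi (rval (z : E R).1))%:E < +oo)%E.
  by apply: le_lt_trans fin; rewrite leeDl.
have sfin : (\sum_(1 <= k <oo) m (slice k) < +oo)%E.
  by apply: le_lt_trans fin; rewrite leeDr.
have partial N : (\sum_(1 <= k < N) m (slice k) <= \sum_(1 <= k <oo) m (slice k))%E.
  by apply: nneseries_lim_ge => k _ _; exact: measure_ge0.
have kfin k : (0 < k)%N -> (m (slice k) < +oo)%E.
  move=> k0; apply: le_lt_trans sfin; apply: le_trans (partial k.+1).
  by rewrite big_nat_recr//= leeDr// sume_ge0.
have iphi : m.-integrable (slice 0) (EFin \o (fun z : borel (E R) => C * phi (rval (z : E R).1))).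
  rewrite (_ : _ \o _ = (fun z : borel (E R) => C%:E * (EFin \o (fun z : borel (E R) => phi (rval (z : E R).1))) z)%E)//.
  apply: (integrableZl (ms 0%N) C); apply/integrableP; split.
    apply/measurable_EFinP; apply: measurable_funS measurableT _ _ => //.
    exact: measurableT_comp mphi measurable_rval1.
  rewrite (eq_integral (fun z : borel (E R) => (phi (rval (z : E R).1))%:E))// => z _ /=.
  by rewrite ger0_norm// phi0// rval_ge0.
have ig k : m.-integrable (slice k) (EFin \o (fun z : borel (E R) => g (rval (z : E R).1) k)).
  case: k => [|k].
    apply: (le_integrable (ms 0%N) _ _ iphi); first exact/measurable_EFinP.
    move=> z _ /=; rewrite lee_fin (le_trans (g0 _ _)) ?rval_ge0// ler_norm//.
  apply: measurable_bounded_integrable => //; first exact: kfin.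
  exists C; split; first exact: num_real.
  by move=> M CM z _ /=; rewrite (le_trans (gk _ _ _ _)) ?rval_ge0// ltW.
split=> //.
pose w k := if k is 0 then `|\int[m]_(z in slice 0) g (rval (z : E R).1) 0%N|
  else C * fine (m (slice k)).
have wk k : `|\int[m]_(z in slice k) g (rval (z : E R).1) k| <= w k.
  case: k => [|k] //=.
  apply: (le_trans (le_normr_Rintegral (ms _) (ig k.+1))).
  rewrite -Rintegral_cst//; apply: le_Rintegral => //.
  - exact: (integrable_norm (ig k.+1)).
  - apply: measurable_bounded_integrable => //; first exact: kfin.
    exists `|C|; split; first exact: num_real.
    by move=> M CM z _ /=; rewrite ltW.
  - by move=> z _; apply: gk; rewrite ?rval_ge0.
apply: normed_cvg; apply: (@series_le_cvg _ _ w) => //.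
- by move=> k /=.
- by move=> k; exact: le_trans (normr_ge0 _) (wk k).
apply: nondecreasing_is_cvgn.
  apply/nondecreasing_seqP => n; rewrite !seriesEnat/= big_nat_recr//= lerDl.
  exact: le_trans (normr_ge0 _) (wk n).
have C0 : 0 <= C by exact: le_trans (normr_ge0 _) (gk 0 1%N (lexx 0) isT).
exists (w 0%N + C * fine (\sum_(1 <= k <oo) m (slice k))%E) => _ [N _ <-].
rewrite seriesEnat /=; case: N => [|N].
  by rewrite big_geq// addr_ge0 ?mulr_ge0 ?fine_ge0.
rewrite big_nat_recl//= lerD2l -mulr_sumr ler_wpM2l//.
rewrite -lee_fin fineK ?ge0_fin_numE//.
apply: le_trans (partial N.+1); rewrite -sumEFin big_add1 /=.
by rewrite (eq_bigr (fun k => m (slice k.+1)))// => k _; rewrite fineK// ge0_fin_numE// kfin.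
Qed.

End jump_integrals.

(** * [Lop] on the exponentials in terms of [Psi_c] and [Psi_d] *)

Section generator_formula.
Context {R : realType}.
Variable p : params R.
Hypothesis padm : admissible p.

Lemma small_jump_bounds (y : R) : 0 <= y -> 0 <= small_jump y <= 1.
Proof.
move=> y0; rewrite /small_jump indicE; case: (boolP (y \in _)) => [|_].
  by rewrite inE/= in_itv/= mulr1 y0 => /andP[_ /ltW].
by rewrite mulr0 lexx ler01.
Qed.

Lemma measurable_small_jump : measurable_fun setT (@small_jump R).
Proof. by apply: measurable_funM => //; exact: measurable_indic. Qed.

Lemma measurable_expRN (q : R) : measurable_fun setT (fun y : R => expR (- (q * y))).
Proof.
apply: continuous_measurable_fun => y.
apply: (@continuous_comp _ _ _ (fun y : R => - (q * y)) expR); last exact: continuous_expR.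
by apply: cvgN; apply: cvgM; [exact: cvg_cst|exact: cvg_id].
Qed.

Lemma expRN_bounds (q y : R) : 0 < q -> 0 <= y -> 0 < expR (- (q * y)) <= 1.
Proof.
move=> q0 y0; rewrite expR_gt0 -[X in _ <= X]expR0 ler_expR oppr_le0 mulr_ge0//.
exact: ltW.
Qed.

Lemma exprn_bounds (r : R) (k : nat) : 0 < r < 1 -> 0 < r ^+ k <= 1.
Proof. by move=> /andP[r0 r1]; rewrite exprn_gt0// exprn_ile1// ltW. Qed.

(** For k = 0 and y < 1 the compensator leaves a second-order remainder of at most q^2 e^q y^2; in
    all other cases the integrand lies in [-1, q]. The constant adds the two bounds. *)
Lemma jump_summable_pi (q r : R) : 0 < q -> 0 < r < 1 ->
  jump_summable (p_pi p) (fun y k => expR (- (q * y)) * r ^+ k - 1 + q * small_jump y).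
Proof.
move=> q0 r01; case: padm => _ [fin _].
apply: (@jump_summable_dominated _ _ _ (fun y => Num.min 1 (y ^+ 2)) (q ^+ 2 * expR q + (1 + q)) _ _ fin).
- apply: measurable_minr; first exact: measurable_cst.
  by apply: measurable_funX; exact: measurable_id.
- by move=> y y0; rewrite le_min ler01 sqr_ge0.
- move=> k; apply: measurable_funD.
    apply: measurable_funB; last exact: measurable_cst.
    by apply: measurable_funM; [exact: measurable_expRN|exact: measurable_cst].
  by apply: measurable_funM; [exact: measurable_cst|exact: measurable_small_jump].
- move=> y y0; rewrite expr0 mulr1.
  have C1 : 1 <= q ^+ 2 * expR q + (1 + q).
    by have := mulr_ge0 (sqr_ge0 q) (expR_ge0 q); lra.
  have [y1|y1] := ltP y 1.
    have [->|yn0] := eqVneq y 0.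
      by rewrite /small_jump mul0r !mulr0 oppr0 expR0 subrr addr0 normr0 expr0n/= minEle ler10 mulr0.
    have yp : 0 < y by rewrite lt_neqAle eq_sym yn0.
    have -> : small_jump y = y.
      by rewrite /small_jump indicE mem_set ?mulr1//= in_itv/= yp.
    rewrite min_r ?expr_le1 ?(ltW y1)//.
    apply: (le_trans (expR_taylor1 _)).
    rewrite exprMn -mulrA [y ^+ 2 * _]mulrC mulrA ler_wpM2r ?sqr_ge0//.
    rewrite ger0_norm ?mulr_ge0 ?(ltW q0)//.
    have : q ^+ 2 * expR (q * y) <= q ^+ 2 * expR q.
      by rewrite ler_wpM2l ?sqr_ge0// ler_expR ler_piMr ?ltW// ltW.
    lra.
  have -> : small_jump y = 0.
    rewrite /small_jump indicE memNset ?mulr0//= in_itv/= => /andP[_].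
    by rewrite ltNge y1.
  rewrite mulr0 addr0 min_l ?mulr1; last by rewrite exprn_ege1.
  have /andP[? ?] := expRN_bounds q0 y0.
  by rewrite ler_norml; apply/andP; split; lra.
- move=> y k y0 _.
  have /andP[a0 a1] := expRN_bounds q0 y0; have /andP[b0 b1] := exprn_bounds k r01.
  have ab0 := mulr_gt0 a0 b0; have ab1 := mulr_ile1 (ltW a0) (ltW b0) a1 b1.
  have /andP[s0 s1] := small_jump_bounds y0.
  have qs0 := mulr_ge0 (ltW q0) s0.
  have qs1 : q * small_jump y <= q by rewrite ler_piMr// ltW.
  have C1 := mulr_ge0 (sqr_ge0 q) (expR_ge0 q).
  by rewrite ler_norml; apply/andP; split; lra.
Qed.

(** The integrand of [Psi_d] divided by r. For k = 0 it is bounded by min(1, qy) <= (1 + q) min(1,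
    y), for k >= 1 by 1. *)
Lemma jump_summable_rho (q r : R) : 0 < q -> 0 < r < 1 ->
  jump_summable (p_rho p) (fun y k => expR (- (q * y)) * r ^+ k - 1).
Proof.
move=> q0 r01; case: padm => _ [_ fin].
apply: (@jump_summable_dominated _ _ _ (fun y => Num.min 1 y) (1 + q) _ _ fin).
- by apply: measurable_minr; [exact: measurable_cst|exact: measurable_id].
- by move=> y y0; rewrite le_min ler01.
- move=> k; apply: measurable_funB; last exact: measurable_cst.
  by apply: measurable_funM; [exact: measurable_expRN|exact: measurable_cst].
- move=> y y0; rewrite expr0 mulr1.
  have /andP[a0 a1] := expRN_bounds q0 y0.
  have h := expR_ge1Dx (- (q * y)).
  have qy := mulr_ge0 (ltW q0) y0.
  by case: (leP 1 y) => y1; rewrite ler_norml; apply/andP; split; lra.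
- move=> y k y0 _.
  have /andP[a0 a1] := expRN_bounds q0 y0; have /andP[b0 b1] := exprn_bounds k r01.
  have ab0 := mulr_gt0 a0 b0; have ab1 := mulr_ile1 (ltW a0) (ltW b0) a1 b1.
  by rewrite ler_norml; apply/andP; split; lra.
Qed.

Lemma Psi_d_jump (q r : R) : 0 < q -> 0 < r < 1 ->
  jump_integral (p_rho p) (fun y k => expR (- (q * y)) * r ^+ k.+1 - r) =
  r * jump_integral (p_rho p) (fun y k => expR (- (q * y)) * r ^+ k - 1).
Proof.
move=> q0 r01.
have := @jump_integral_sum _ (p_rho p) 1 (fun=> r)
  (fun=> fun y k => expR (- (q * y)) * r ^+ k - 1) (fun=> jump_summable_rho q0 r01).
rewrite big_ord_recl big_ord0 addr0 => <-.
apply: jump_integral_ext => y k _; rewrite big_ord_recl big_ord0 addr0 exprS.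
by ring.
Qed.

Lemma fqr_shift (q r : R) (z : E R) (y : R) (k : nat) : 0 <= y ->
  fqr q r (to_Rplus (rval z.1 + y), (z.2 + k)%N) =
  fqr q r z * (expR (- (q * y)) * r ^+ k).
Proof.
move=> y0; rewrite /fqr /= to_RplusK ?addr_ge0 ?rval_ge0// mulrDr opprD expRD exprD.
by ring.
Qed.

(** Derivatives and shifts multiply [fqr q r] by scalars, so [Lop] multiplies it by a linear form in
    (x, l): the terms of [Lop] with factor x collect to [Psi_c], those with factor l to [Psi_d] /
    r. *)
Lemma Lop_span n (c q r : 'I_n -> R) :
  (forall i, 0 < q i /\ 0 < r i < 1) ->
  Lop p (fun z => \sum_(i < n) c i * fqr (q i) (r i) z) =
  (fun z => \sum_(i < n) c i * ((Psi_c p (q i) (r i) * rval z.1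
     + Psi_d p (q i) (r i) / r i * z.2%:R) * fqr (q i) (r i) z)).
Proof.
move=> qr; apply/funext => -[x0 l]; rewrite /Lop.
rewrite !dx_fqr_sum; set x := rval x0.
pose F i := fqr (q i) (r i) (x0, l).
rewrite -/(F _).
have -> : jump_integral (p_pi p) (fun y k =>
    \sum_(i < n) c i * fqr (q i) (r i) (to_Rplus (x + y), (l + k)%N)
    - \sum_(i < n) c i * fqr (q i) (r i) (x0, l)
    - small_jump y * \sum_(i < n) c i * - q i * fqr (q i) (r i) (x0, l)) =
  \sum_(i < n) (c i * F i) * jump_integral (p_pi p)
    (fun y k => expR (- (q i * y)) * r i ^+ k - 1 + q i * small_jump y).
  rewrite -(@jump_integral_sum _ _ _ (fun i => c i * F i)); last first.
    by move=> i; have [] := qr i; exact: jump_summable_pi.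
  apply: jump_integral_ext => y k y0.
  rewrite mulr_sumr -!sumrB; apply: eq_bigr => i _.
  by rewrite (@fqr_shift _ _ (x0, l))// -/(F i); ring.
have -> : jump_integral (p_rho p) (fun y k =>
    \sum_(i < n) c i * fqr (q i) (r i) (to_Rplus (x + y), (l + k)%N)
    - \sum_(i < n) c i * fqr (q i) (r i) (x0, l)) =
  \sum_(i < n) (c i * F i) * jump_integral (p_rho p)
    (fun y k => expR (- (q i * y)) * r i ^+ k - 1).
  rewrite -(@jump_integral_sum _ _ _ (fun i => c i * F i)); last first.
    by move=> i; have [] := qr i; exact: jump_summable_rho.
  apply: jump_integral_ext => y k y0.
  rewrite -!sumrB; apply: eq_bigr => i _.
  by rewrite (@fqr_shift _ _ (x0, l))// -/(F i); ring.
have -> : p_d p * l%:R * (\sum_(i < n) c i * fqr (q i) (r i) (x0, l.-1)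
    - \sum_(i < n) c i * fqr (q i) (r i) (x0, l)) =
  \sum_(i < n) p_d p * l%:R * (c i * F i * (1 / r i - 1)).
  rewrite -sumrB mulr_sumr; apply: eq_bigr => i _.
  have [_ /andP[r0 _]] := qr i.
  (* At l = 0 the truncated predecessor is harmless, since the factor l vanishes. *)
  rewrite /F /fqr /= {F}; case: l => [|l]; first by rewrite !mulr0 !mul0r.
  by rewrite /= exprS; field; rewrite gt_eqF.
rewrite !mulr_sumr -!sumrN -!big_split /=.
apply: eq_bigr => i _; have [q0 r01] := qr i.
rewrite /Psi_c /Psi_d Psi_d_jump// -/(F i).
have [_ /andP[r0 _]] := qr i.
by field; rewrite gt_eqF.
Qed.

End generator_formula.

(** * The associated process *)

Section measures_on_ED.
Context {R : realType}.

(** A point of E is the level set at 1 of a continuous function that is below 1 elsewhere; the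
    extension by 0 keeps [None] out. *)
Lemma measurable_point (z : ED R) : measurable ([set z] : set (borel (ED R))).
Proof.
case: z => [w|]; last exact: measurable_None.
pose g (v : E R) := expR (- (`|rval v.1 - rval w.1| + `|v.2%:R - w.2%:R|)).
have cg : continuous g.
  apply: continuous_E => n x.
  apply: (@continuous_comp _ _ _ (@rval R)
    (fun r => expR (- (`|r - rval w.1| + `|n%:R - w.2%:R|)))).
    exact: rval_continuous.
  apply: (@continuous_comp _ _ _ (fun r : R => - (`|r - rval w.1| + `|n%:R - w.2%:R|)) expR); last exact: continuous_expR.
  apply: cvgN; apply: cvgD; last exact: cvg_cst.
  by apply: cvg_norm; apply: cvgB; [exact: cvg_id|exact: cvg_cst].
have := ext0_measurable cg; move=> /(_ measurableT [set 1]).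
rewrite setTI (_ : _ @^-1` _ = [set Some w]); first by apply; exact: measurable_set1.
apply/seteqP; split => [[v|]|_ ->] /=.
- move=> /eqP; rewrite -expR0 => /eqP/expR_inj/eqP; rewrite oppr_eq0 paddr_eq0//.
  rewrite !normr_eq0 !subr_eq0 eqr_nat => /andP[/eqP/rval_inj h1 /eqP h2].
  by case: v h1 h2 => a b /= -> ->; case: (w).
- by move=> /eqP; rewrite eq_sym oner_eq0.
- by rewrite /g !subrr normr0 addr0 oppr0 expR0.
Qed.

Lemma probability_point d (T : measurableType d) (nu : probability T R)
    (z : T) (A : set T) :
  measurable [set z] -> measurable A -> nu [set z] = 1%E -> nu A = (\d_z A)%R.
Proof.
move=> mz mA nz; rewrite diracE; case: (boolP (z \in A)) => zA.
  apply/eqP; rewrite eq_le probability_le1//= -nz.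
  by rewrite le_measure ?inE// => _ ->; exact: set_mem.
have : (nu A + nu [set z] <= 1)%E.
  rewrite -measureU//; last first.
    by apply/seteqP; split => // y [Ay /= yz]; move: zA; rewrite -yz mem_set.
  by apply: probability_le1; exact: measurableU.
rewrite nz => h; apply/eqP; rewrite eq_le measure_ge0 andbT.
by rewrite -(@leeD2rE _ 1%E)// add0e.
Qed.

Lemma mean_dirac (nu : probability (borel (ED R)) R) (z : ED R) (f : E R -> R) :
  C0 f -> (forall A, measurable A -> nu A = (\d_(z : borel (ED R)) A)%R) ->
  mean nu f = ext0 f z.
Proof.
move=> f0 nz; apply: EFin_inj; rewrite -meanE//.
rewrite (eq_measure_integral (\d_(z : borel (ED R)))); last first.
  by move=> A mA _; exact: nz.
rewrite integral_dirac//; first by rewrite diracT mul1e.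
by apply/measurable_EFinP; exact: C0_ext0_measurable.
Qed.

(** A sum at level k comes from levels j and k - j, which makes the preimage of a box a finite
    union. *)
Lemma measurable_addED :
  measurable_fun setT (fun zw : borel (ED R) * borel (ED R) =>
    addED zw.1 zw.2 : borel (ED R)).
Proof.
(* The added 1 makes positivity of [ext0 (e j)] equivalent to lying at level j, even when x = 0; two
   such shifts turn the bound a into a + 2. *)
pose e (j : nat) (v : E R) : R := if v.2 == j then rval v.1 + 1 else 0.
have me j : measurable_fun setT (ext0 (e j) : borel (ED R) -> R).
  apply: ext0_measurable; apply: continuous_E => n x.
  rewrite /e /=; case: (n == j); last exact: cst_continuous.
  apply: (@continuous_comp _ _ _ (@rval R) (fun r => r + 1)).
    exact: rval_continuous.
  by apply: cvgD; [exact: cvg_id|exact: cvg_cst].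
have me1 j : measurable_fun setT (fun zw : borel (ED R) * borel (ED R) => ext0 (e j) zw.1).
  exact: measurableT_comp (me j) measurable_fst.
have me2 j : measurable_fun setT (fun zw : borel (ED R) * borel (ED R) => ext0 (e j) zw.2).
  exact: measurableT_comp (me j) measurable_snd.
apply: (measurability _ borel_ED_boxes) => _ [_ [->|[k [a ->]]] <-].
  by rewrite setTI preimage_setT.
rewrite setTI (_ : _ @^-1` _ = \bigcup_(j in `I_k.+1)
  [set zw : borel (ED R) * borel (ED R) |
    [/\ 0 < ext0 (e j) zw.1, 0 < ext0 (e (k - j)%N) zw.2 &
    ext0 (e j) zw.1 + ext0 (e (k - j)%N) zw.2 < a + 2]]).
  apply: bigcup_measurable => j _.
  have -> : [set zw : borel (ED R) * borel (ED R) |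
    [/\ 0 < ext0 (e j) zw.1, 0 < ext0 (e (k - j)%N) zw.2 &
    ext0 (e j) zw.1 + ext0 (e (k - j)%N) zw.2 < a + 2]] =
    ((fun zw : borel (ED R) * borel (ED R) => ext0 (e j) zw.1) @^-1` `]0, +oo[
     `&` (fun zw : borel (ED R) * borel (ED R) => ext0 (e (k - j)%N) zw.2) @^-1` `]0, +oo[)
     `&` (fun zw : borel (ED R) * borel (ED R) =>
       ext0 (e j) zw.1 + ext0 (e (k - j)%N) zw.2) @^-1` `]-oo, a + 2[.
    apply/seteqP; split => zw /=; rewrite !in_itv /= !andbT; first by case.
    by case=> -[].
  apply: measurableI; first apply: measurableI.
  - by rewrite -[X in measurable X]setTI; apply: me1.
  - by rewrite -[X in measurable X]setTI; apply: me2.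
  - by rewrite -[X in measurable X]setTI; apply: (measurable_funD (me1 j) (me2 _)).
have xa (x y : Rplus R) : (rval x + 1 + (rval y + 1) < a + 2) = (rval (addRplus x y) < a).
  by rewrite rval_add; apply/idP/idP; lra.
apply/seteqP; split => -[[[x n]|] [[y m]|]] /=; try by case.
- rewrite box_SomeE => -[h nmk]; exists n => /=; first by rewrite ltnS -nmk leq_addr.
  rewrite /e /= eqxx -nmk addKn eqxx xa.
  by split=> //; rewrite ltr_wpDl ?rval_ge0.
- case=> j /= jk []; rewrite /e /=; case: eqP => [->|]; rewrite ?ltxx//.
  case: eqP => [->|]; rewrite ?ltxx// => _ _; rewrite xa => h.
  by rewrite box_SomeE subnKC.
- by case=> j _ []; rewrite ltxx.
- by case=> j _ []; rewrite ltxx.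
- by case=> j _ []; rewrite ltxx.
Qed.

Lemma mean_sum nu n (c : 'I_n -> R) (F : 'I_n -> E R -> R) :
  (forall i, C0 (F i)) ->
  mean nu (fun z => \sum_(i < n) c i * F i z) = \sum_(i < n) c i * mean nu (F i).
Proof.
elim: n c F => [|n IH] c F F0.
  rewrite big_ord0 (_ : (fun z => _) = fun=> 0); last first.
    by apply/funext => z; rewrite big_ord0.
  apply/eqP; rewrite -normr_le0; apply: mean_le => [|z]; first exact: C0_0.
  by rewrite normr0.
rewrite big_ord_recl -(IH (fun i => c (lift ord0 i)) (fun i => F (lift ord0 i)))//.
rewrite -mean_lin//; last first.
  by apply: (@C0_sum _ _ _ (fun i z => c (lift ord0 i) * F (lift ord0 i) z)) => i; exact: C0_scale.
by congr (mean nu _); apply/funext => z; rewrite big_ord_recl.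
Qed.

Lemma span_fqr_C0 (f : E R -> R) : span_fqr f -> C0 f.
Proof.
move=> [n [c [q [r [qr ->]]]]].
apply: (@C0_sum _ _ _ (fun i z => c i * fqr (q i) (r i) z)) => i.
by apply: C0_scale; have [] := qr i; exact: fqr_in_C0.
Qed.

(** Density of the span extends the agreement to C_0(E), where [mean_unique] applies. *)
Lemma mean_fqr_unique (mu nu : probability (borel (ED R)) R) :
  (forall q r : R, 0 < q -> 0 < r < 1 -> mean mu (fqr q r) = mean nu (fqr q r)) ->
  forall A, measurable A -> mu A = nu A.
Proof.
move=> mn; apply: mean_unique => f f0; apply/eqP; rewrite -subr_eq0 -normr_le0.
apply/ler_addgt0Pr => e e0; rewrite add0r.
have [g sg fg] := span_fqr_dense f0 (divr_gt0 e0 (ltr0Sn R 1)).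
have g0 := span_fqr_C0 sg.
have h1 := mean_dist mu f0 g0 fg; have h2 := mean_dist nu f0 g0 fg.
have h3 : mean mu g = mean nu g.
  case: sg => [n [c [q [r [qr ->]]]]].
  rewrite !mean_sum => [|i|i]; try by have [] := qr i; exact: fqr_in_C0.
  by apply: eq_bigr => i _; have [? ?] := qr i; rewrite mn.
move: h1 h2; rewrite h3 !ler_norml => /andP[? ?] /andP[? ?].
by apply/andP; split; lra.
Qed.

Lemma ext0_fqr_add (q r : R) (z w : ED R) :
  ext0 (fqr q r) (addED z w) = ext0 (fqr q r) z * ext0 (fqr q r) w.
Proof.
case: z w => [[x n]|] [[y m]|] //=; rewrite ?mulr0 ?mul0r//.
by rewrite /fqr /= rval_add mulrDr opprD expRD exprD; ring.
Qed.

(** By Tonelli and the multiplicativity of [ext0 (fqr q r)] under [addED], the convolution has the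
    product of the two transforms. *)
Lemma convolution_fqr (mu nu rho : probability (borel (ED R)) R) :
  (forall q r : R, 0 < q -> 0 < r < 1 ->
     mean rho (fqr q r) = mean mu (fqr q r) * mean nu (fqr q r)) ->
  forall A, measurable A -> rho A = convolution mu nu A.
Proof.
(* Bundling addition and the product measure exhibits the convolution as a [distribution], hence as
   a probability to which uniqueness applies. *)
move=> h A mA; pose add : {mfun (borel (ED R) * borel (ED R))%type >-> borel (ED R)} :=
  HB.pack (fun zw : borel (ED R) * borel (ED R) => addED zw.1 zw.2 : borel (ED R))
    (isMeasurableFun.Build _ _ _ _ _ measurable_addED).
pose pi : probability (borel (ED R) * borel (ED R))%type R := (mu \x nu)%E.
change (rho A = distribution pi add A); move: A mA; apply: mean_fqr_unique => q r q0 r01.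
rewrite h//; apply: EFin_inj; rewrite EFinM -[in RHS]meanE; last exact: fqr_in_C0.
have F0 (w : borel (ED R)) : (0 <= (ext0 (fqr q r) w)%:E)%E.
  rewrite lee_fin; case: w => [w|] //=.
  by have /andP[] := fqr_decay q w (proj1 (andP r01)).
have mF : measurable_fun setT (EFin \o (ext0 (fqr q r) : borel (ED R) -> R)).
  by apply/measurable_EFinP; apply: C0_ext0_measurable; exact: fqr_in_C0.
rewrite ge0_integral_distribution//.
rewrite fubini_tonelli1//; last 2 first.
- exact: measurableT_comp mF measurable_addED.
- by move=> x; exact: F0.
rewrite /fubini_F /=.
under eq_integral.
  move=> z _.
  under eq_integral => w _ do rewrite ext0_fqr_add EFinM.
  rewrite ge0_integralZl//= meanE; last exact: fqr_in_C0.
  rewrite muleC; over.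
rewrite ge0_integralZl//=; last first.
  by rewrite lee_fin; apply: mean_ge0 => w; have /andP[] := fqr_decay q w (proj1 (andP r01)).
rewrite muleC; congr (_ * _)%E.
by apply/esym; apply: meanE; exact: fqr_in_C0.
Qed.

End measures_on_ED.

(** * Transition laws and semigroup of the associated process *)

Section process.
Context {R : realType} (p : params R) {d : measure_display}
  {Omega : measurableType d}.
Variables (P : ED R -> probability Omega R)
  (X : Rplus R -> {mfun Omega >-> borel (ED R)}).
Hypothesis PX : associated_process p P X.

(** [transition] bundled as a probability, so that [mean] applies to it. *)
Let law t z : probability (borel (ED R)) R := distribution (P z) (X t).

Lemma semigroupE t f z : semigroup P X t f z = mean (law t (Some z)) f.
Proof. by []. Qed.

Lemma law0 z A : measurable A -> law (Rplus0 R) z A = (\d_(z : borel (ED R)) A)%R.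
Proof.
move=> mA; case: PX => h0 _ _ _ _.
by apply: probability_point => //; [exact: measurable_point|exact: h0].
Qed.

(** By the cemetery property, the event X_0 = Delta, which has probability 1, is contained in X_t =
    Delta. *)
Lemma law_None t A : measurable A ->
  law t None A = (\d_(None : borel (ED R)) A)%R.
Proof.
move=> mA; case: PX => h0 _ hc _ _.
apply: probability_point => //; first exact: measurable_None.
apply/eqP; rewrite eq_le probability_le1 /=; last exact: measurable_None.
rewrite -(h0 None); apply: le_measure.
- rewrite inE -[X in measurable X]setTI; apply: measurable_funPT => //; exact: measurable_None.
- rewrite inE -[X in measurable X]setTI; apply: measurable_funPT => //; exact: measurable_None.
- by move=> w /= Xw; apply: (hc w (Rplus0 R)) => //; exact: rval_ge0.
Qed.

(** The strong Markov property at the deterministic time s, conditioning on the whole space. *)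
Lemma law_add s t z A : measurable A ->
  law (addRplus s t) z A = (\int[law s z]_v law t v A)%E.
Proof.
move=> mA; case: PX => _ _ _ [mP sm] _.
have full r : [set w : Omega | ((rval s)%:E <= (rval r)%:E)%E] = setT \/
    [set w : Omega | ((rval s)%:E <= (rval r)%:E)%E] = set0.
  have [h|h] := leP (rval s) (rval r).
    by left; apply/seteqP; split => // w _ /=; rewrite lee_fin.
  by right; apply/seteqP; split => // w /=; rewrite lee_fin leNgt h.
have hist r : history X r [set w : Omega | ((rval s)%:E <= (rval r)%:E)%E].
  case: (full r) => ->; last exact: sigma_algebra0.
  by rewrite -setC0 -setTD; apply: sigma_algebraCD; exact: sigma_algebra0.
have st : stopping_time X (fun=> (rval s)%:E).
  by split=> // w; rewrite lee_fin rval_ge0.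
have sh : stopped_history X (fun=> (rval s)%:E) setT.
  by split=> [|r]; [exact: measurableT|rewrite setTI].
have := sm z _ t A setT st mA sh.
rewrite /= !rvalK.
have -> : [set: Omega] `&` [set w : Omega | ((rval s)%:E < +oo)%E] = setT.
  by rewrite setTI; apply/seteqP; split => // w _ /=; rewrite ltry.
rewrite setTI => h; rewrite [LHS]h.
by rewrite ge0_integral_distribution//; exact: mP.
Qed.

(** Chapman-Kolmogorov for functions, read as integration against a [giry_bind]. At [None] the inner
    mean is 0 by absorption, in agreement with [ext0]. *)
Lemma mean_law_add s t z f : C0 f -> (forall w, 0 <= f w) ->
  mean (law (addRplus s t) z) f = mean (law s z) (fun w => mean (law t (Some w)) f).
Proof.
move=> f0 fge0.
have mk : measurable_fun setT (fun v : borel (ED R) => law t v : giry (borel (ED R)) R).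
  apply: measurable_giry_codensity => // B mB.
  by case: PX => _ _ _ [mP _] _; exact: mP.
have bindE A : measurable A ->
    law (addRplus s t) z A = giry_bind (law s z : giry (borel (ED R)) R) mk A.
  move=> mA; rewrite law_add//.
  have := @giry_int_bind _ _ _ _ R (law s z) _ mk (fun v => (\1_A v)%:E).
  rewrite /giry_int integral_indic// setIT => -> //.
  - by apply: eq_integral => v _; rewrite integral_indic// setIT.
  - by apply/measurable_EFinP; exact: measurable_indic.
have F0 (w : borel (ED R)) : (0 <= (ext0 f w)%:E)%E.
  by rewrite lee_fin; case: w => [w|] /=.
apply: (congr1 fine); rewrite (eq_measure_integral (giry_bind (law s z : giry (borel (ED R)) R) mk)); last first.
  by move=> A mA _; exact: bindE.
have := @giry_int_bind _ _ _ _ R (law s z) _ mk (fun v => (ext0 f v)%:E).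
rewrite /giry_int => -> //; last by apply/measurable_EFinP; exact: C0_ext0_measurable.
apply: eq_integral => -[w|] _; first exact: meanE.
by rewrite meanE// (mean_dirac f0 (@law_None t)).
Qed.

Variables (u f : R -> R -> Rplus R -> R).
Hypothesis uf_flow : forall q r : R, 0 < q -> 0 < r < 1 ->
  flow_solution p q r (u q r) (f q r).
Hypothesis P_fqr : forall t x n (q r : R), 0 < q -> 0 < r < 1 ->
  semigroup P X t (fqr q r) (x, n) =
  expR (- (rval x * u q r t)) * f q r t ^+ n.

Lemma semigroup_fqr t q r : 0 < q -> 0 < r < 1 ->
  semigroup P X t (fqr q r) = fqr (u q r t) (f q r t).
Proof.
by move=> q0 r01; apply/funext => -[x n]; rewrite P_fqr// /fqr /= [rval x * _]mulrC.
Qed.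

Lemma flow_range t q r : 0 < q -> 0 < r < 1 -> 0 < u q r t /\ 0 < f q r t < 1.
Proof. by move=> q0 r01; have [_ h _ _] := uf_flow q0 r01; exact: h. Qed.

Lemma semigroup_span_sum t n (c q r : 'I_n -> R) :
  (forall i, 0 < q i /\ 0 < r i < 1) ->
  semigroup P X t (fun z => \sum_(i < n) c i * fqr (q i) (r i) z) =
  (fun z => \sum_(i < n) c i * fqr (u (q i) (r i) t) (f (q i) (r i) t) z).
Proof.
move=> qr; apply/funext => z; rewrite semigroupE mean_sum; last first.
  by move=> i; have [] := qr i; exact: fqr_in_C0.
by apply: eq_bigr => i _; have [? ?] := qr i; rewrite -semigroupE semigroup_fqr.
Qed.

Lemma semigroup_span t g : span_fqr g -> span_fqr (semigroup P X t g).
Proof.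
move=> [n [c [q [r [qr ->]]]]]; rewrite semigroup_span_sum//.
exists n, c, (fun i => u (q i) (r i) t), (fun i => f (q i) (r i) t); split=> // i.
by have [? ?] := qr i; exact: flow_range.
Qed.

Lemma semigroup_sup_dist t g h e : C0 g -> C0 h -> sup_dist_le g h e ->
  sup_dist_le (semigroup P X t g) (semigroup P X t h) e.
Proof. by move=> g0 h0 gh z; exact: mean_dist. Qed.

Lemma semigroup_C0 t g : C0 g -> C0 (semigroup P X t g).
Proof.
move=> g0; apply: C0_closed => e e0; have [h sh gh] := span_fqr_dense g0 e0.
exists (semigroup P X t h); first exact/span_fqr_C0/semigroup_span.
by apply: semigroup_sup_dist => //; exact: span_fqr_C0.
Qed.

Lemma fqr_generator q r : 0 < q -> 0 < r < 1 ->
  generator (semigroup P X) (fqr q r)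
    (fun z => (Psi_c p q r * rval z.1 + Psi_d p q r / r * z.2%:R) * fqr q r z).
Proof.
move=> q0 r01; split; first exact: fqr_in_C0.
  have := @fqr_C0 _ q r (Psi_c p q r) (Psi_d p q r / r) 0 q0 r01.
  by congr C0; apply/funext => z; rewrite addr0.
move=> e e0; apply/near_dRplus0P.
have [[u0 f0] uf du df] := uf_flow q0 r01.
have du0 := du (Rplus0 R); have df0 := df (Rplus0 R); rewrite u0 f0 in du0 df0.
have [D D0 hD] := fqr_flow_derivative uf du0 df0 e0.
exists D => // t tD z; have := hD t tD z.
by rewrite u0 f0 semigroup_fqr.
Qed.

(** The difference quotient is eventually bounded by M + 1, so T_t g - g is of order t. The argument
    avoids [is_feller], which strong continuity is meant to establish. *)
Lemma generator_strongly_continuous g h e : generator (semigroup P X) g h ->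
  0 < e -> \forall t \near Rplus0 R, sup_dist_le (semigroup P X t g) g e.
Proof.
move=> [g0 h0 gen] e0; apply/near_Rplus0P.
have [M Mh] := C0_bounded h0.
have M0 : 0 <= M by apply: le_trans (normr_ge0 _) (Mh (Rplus0 R, 0%N)).
have /near_dRplus0P[D D0 hD] := gen 1 ltr01.
have M1 : 0 < M + 1 by rewrite ltr_wpDl.
exists (Num.min D (e / (M + 1))); first by rewrite lt_min D0 divr_gt0.
move=> t; rewrite lt_min => /andP[tD te] z.
have [t0|t0] := leP (rval t) 0.
  have -> : t = Rplus0 R by apply: rval_inj; apply/eqP; rewrite eq_le t0 rval_ge0.
  by rewrite semigroupE (mean_dirac g0 (@law0 (Some z))) /= subrr normr0 ltW.
have := hD t; rewrite t0 tD => /(_ isT z) /= h1.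
have h2 : `|(semigroup P X t g z - g z) / rval t| <= M + 1.
  have := ler_normD ((semigroup P X t g z - g z) / rval t - h z) (h z).
  by rewrite subrK; have := Mh z; lra.
move: h2; rewrite normrM normfV (gtr0_norm t0) ler_pdivrMr// => /le_trans; apply.
by rewrite mulrC -ler_pdivlMr// ltW.
Qed.

(** Three times e/3: contractivity handles the approximation of g on both sides, and the span is
    treated by induction on the number of exponentials. *)
Lemma semigroup_strongly_continuous g e : C0 g -> 0 < e ->
  \forall t \near Rplus0 R, sup_dist_le (semigroup P X t g) g e.
Proof.
move=> g0 e0; have e3 : 0 < e / 3 by rewrite divr_gt0.
have [h sh gh] := span_fqr_dense g0 e3; have h0 := span_fqr_C0 sh.
suff : forall eps : R, 0 < eps -> exists2 D : R, 0 < D & forall t, rval t < D ->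
    sup_dist_le (semigroup P X t h) h eps.
  move=> /(_ _ e3)[D D0 hD]; apply/near_Rplus0P; exists D => // t tD.
  have -> : e = e / 3 + e / 3 + e / 3 by lra.
  apply: (sup_dist_le_trans _ (sup_dist_le_sym gh)).
  apply: (sup_dist_le_trans _ (hD t tD)).
  exact: semigroup_sup_dist.
case: sh => n [c [q [r [qr ->]]]].
elim: n c q r qr => [|n IH] c q r qr eps eps0.
  exists 1 => // t _ z; rewrite semigroup_span_sum// !big_ord0 subrr normr0.
  exact: ltW.
have eps20 : 0 < eps / 2 by rewrite divr_gt0.
have [D D0 hD] := IH (fun i => c (lift ord0 i)) (fun i => q (lift ord0 i))
  (fun i => r (lift ord0 i)) (fun i => qr _) _ eps20.
have [q0 r01] := qr ord0.
have a1 : 0 < `|c ord0| + 1 by rewrite ltr_wpDl.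
have /near_Rplus0P[D' D'0 hD'] :=
  generator_strongly_continuous (fqr_generator q0 r01) (divr_gt0 eps20 a1).
exists (Num.min D D'); first by rewrite lt_min D0.
move=> t; rewrite lt_min => /andP[tD tD'] z.
have := hD t tD z; have := hD' t tD' z; rewrite semigroup_fqr//.
rewrite (semigroup_span_sum t c qr).
rewrite (semigroup_span_sum t (fun i => c (lift ord0 i)) (fun i => qr (lift ord0 i))).
rewrite !big_ord_recl => h1 h2.
rewrite opprD addrACA -mulrBr [leRHS]splitr (le_trans (ler_normD _ _))// lerD// normrM.
apply: (@le_trans _ _ ((`|c ord0| + 1) * (eps / 2 / (`|c ord0| + 1)))).
  by rewrite ler_pM// lerDl.
by rewrite mulrCA divff ?gt_eqF// mulr1.
Qed.

(** [mean_law_add] asks for nonnegative functions; the exponentials are nonnegative, linearity gives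
    the span with signed coefficients, and density gives C_0(E). *)
Lemma semigroup_add s t g : C0 g ->
  semigroup P X (addRplus s t) g = semigroup P X s (semigroup P X t g).
Proof.
move=> g0; apply/funext => z; apply/eqP; rewrite -subr_eq0 -normr_le0.
apply/ler_addgt0Pr => e e0; rewrite add0r.
have [h sh gh] := span_fqr_dense g0 (divr_gt0 e0 (ltr0Sn R 1)).
have h0 := span_fqr_C0 sh.
have h1 := semigroup_sup_dist (addRplus s t) g0 h0 gh z.
have h2 := semigroup_sup_dist s (semigroup_C0 t g0) (semigroup_C0 t h0)
  (semigroup_sup_dist t g0 h0 gh) z.
have h3 : semigroup P X (addRplus s t) h z = semigroup P X s (semigroup P X t h) z.
  case: sh => n [c [q [r [qr ->]]]].
  rewrite (semigroup_span_sum t)// !semigroupE !mean_sum.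
  - apply: eq_bigr => i _; have [q0 r01] := qr i.
    have f0 w : 0 <= fqr (q i) (r i) w by have /andP[] := fqr_decay (q i) w (proj1 (andP r01)).
    rewrite mean_law_add//; last exact: fqr_in_C0.
    by congr (_ * mean _ _); rewrite -[RHS]semigroup_fqr.
  - by move=> i; have [q0 r01] := qr i; have [] := flow_range t q0 r01; exact: fqr_in_C0.
  - by move=> i; have [] := qr i; exact: fqr_in_C0.
move: h1 h2; rewrite h3 !ler_norml => /andP[? ?] /andP[? ?].
by apply/andP; split; lra.
Qed.

Lemma semigroup_feller : is_feller (semigroup P X).
Proof.
split.
- by move=> t g; exact: semigroup_C0.
- by move=> t a g h g0 h0; apply/funext => z; exact: mean_lin.
- split=> [g g0|s t g]; last exact: semigroup_add.
  by apply/funext => z; rewrite semigroupE (mean_dirac g0 (@law0 (Some z))).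
- by split=> [t g _ g0 z|t g M g0 gM z]; [exact: mean_ge0|exact: mean_le].
- by move=> g e; exact: semigroup_strongly_continuous.
Qed.

Lemma span_generator (padm : admissible p) g : span_fqr g ->
  generator (semigroup P X) g (Lop p g).
Proof.
move=> [n [c [q [r [qr ->]]]]]; rewrite Lop_span//.
elim: n c q r qr => [|n IH] c q r qr.
  have := generator0 semigroup_feller; congr generator; apply/funext => z; by rewrite big_ord0.
have [q0 r01] := qr ord0.
have := generator_lin semigroup_feller (c ord0) (fqr_generator q0 r01)
  (IH (fun i => c (lift ord0 i)) (fun i => q (lift ord0 i)) (fun i => r (lift ord0 i)) (fun i => qr _)).
by congr generator; apply/funext => z; rewrite big_ord_recl.
Qed.

Lemma branching t x y n m A : measurable A ->
  transition P X t (Some (addRplus x y, (n + m)%N)) A =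
  convolution (transition P X t (Some (x, n))) (transition P X t (Some (y, m))) A.
Proof.
move: A; apply: (@convolution_fqr _ (law t (Some (x, n))) (law t (Some (y, m)))
  (law t (Some (addRplus x y, (n + m)%N)))) => q r q0 r01.
rewrite -!semigroupE !P_fqr// rval_add mulrDl opprD expRD exprD.
by ring.
Qed.

End process.

Theorem proposition2p3 (R : realType) (p : params R)
  (padm : admissible p)
  (d : measure_display) (Omega : measurableType d)
  (P : ED R -> probability Omega R)
  (X : Rplus R -> {mfun Omega >-> borel (ED R)})
  (PX : associated_process p P X)
  (u f : R -> R -> Rplus R -> R)
  (uf_flow : forall q r : R, 0 < q -> 0 < r < 1 ->
     flow_solution p q r (u q r) (f q r))
  (P_fqr : forall t x n (q r : R), 0 < q -> 0 < r < 1 ->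
     semigroup P X t (fqr q r) (x, n) =
     expR (- (rval x * u q r t)) * f q r t ^+ n) :
  [/\ is_feller (semigroup P X),
      forall t A, measurable A ->
        transition P X t None A = dirac (None : borel (ED R)) A,
      forall t g, span_fqr g -> span_fqr (semigroup P X t g),
      is_core (generator (semigroup P X)) span_fqr /\
        (forall g, span_fqr g -> generator (semigroup P X) g (Lop p g)) &
      forall t x y n m A, measurable A ->
        transition P X t (Some (addRplus x y, (n + m)%N)) A =
        convolution (transition P X t (Some (x, n)))
                    (transition P X t (Some (y, m))) A].
Proof.
have feller := semigroup_feller PX uf_flow P_fqr.
have inv t g := @semigroup_span _ _ _ _ _ _ _ _ uf_flow P_fqr t g.
have gen g := @span_generator _ _ _ _ _ _ PX _ _ uf_flow P_fqr padm g.
split=> //.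
- by move=> t A; exact: (law_None PX).
- split=> //; apply: (is_core_dense feller) => //.
  + exact: span_fqr0.
  + by move=> a g h; exact: span_fqr_lin.
  + by move=> g sg; exists (Lop p g); exact: gen.
  + by move=> g e g0; exact: span_fqr_dense.
- by move=> t x y n m A; exact: (branching P_fqr).
Qed.
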